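(* Let Assumption A hold. Then $w(\lambda\pm i0)\ne0$ for all $\lambda>0$, and for each $\lambda>0$ the regular solution satisfies \[ \varphi(x,\lambda)=\frac{\kappa(\lambda)}{\sqrt{p_0\lambda}\,K(\lambda)}\sin\big(\Phi(x,\lambda)-\eta(\lambda)\big)+O(\varepsilon(x)),\qquad x\to\infty . \] In particular, the operator $H$ has no positive eigenvalues.
   Context: Assumption A: $p>0$ absolutely continuous on $\mathbb R_+$, $p'\in L^1(\mathbb R_+)$, $p(x)\to p_0>0$; $q$ real, $q\in L^1(0,x_0)$, absolutely continuous on $[x_0,\infty)$, $q'\in L^1(x_0,\infty)$, $q(x)\to0$. $\varepsilon(x)=\int_x^\infty(|p'|+|q'|)dy$; $(A)_+=(|A|+A)/2$; $\Phi(x,\lambda)=\int_0^x\sqrt{((\lambda-q)/p)_+}\,dy$, $K(\lambda)=\exp(-\int_0^\infty\sqrt{((q-\lambda)/p)_+}\,dy)$. Modified Jost solution $\theta(x,z)$ ($z\in\mathbb C\setminus\mathbb R$ or $z=\lambda\pm i0$, $\lambda\ne0$): with $\omega=\sqrt{(q-z)/p}$ ($\Re\omega>0$, boundary values on the cut) and $a(x,z)=\exp(-\int_0^x\omega\,dy)$, $\theta$ is the solution of $-(p\theta')'+q\theta=z\theta$ with $\theta(x,z)=a(x,z)(1+O(\varepsilon(x)))$ as $x\to\infty$ (constructed as $a u$, $u$ the bounded solution of $u(x)=1+\int_x^\infty a(y)^2\big(\int_x^yp^{-1}a^{-2}ds\big)(p\omega)'(y)u(y)dy$). The regular solution $\varphi(x,z)$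 solves $-(p\varphi')'+q\varphi=z\varphi$ with $\varphi(0,z)=0$, $\varphi'(0,z)=1$. The Wronskian $w(z)=p(x)(\varphi'\theta-\varphi\theta')=p(0)\theta(0,z)$. For $\lambda>0$: $\kappa(\lambda)=|w(\lambda\pm i0)|$ and $\eta(\lambda)$ is a continuous function with $w(\lambda+i0)=\kappa(\lambda)e^{i\eta(\lambda)}$. $H$ is the self-adjoint operator $-\frac{d}{dx}p\frac{d}{dx}+q$ in $L^2(\mathbb R_+)$ with boundary condition $f(0)=0$ (defined via the closed quadratic form $\int_0^\infty(p|f'|^2+q|f|^2)dx$ on $H^1_0(\mathbb R_+)$). *)

(* Defs.v *)
From HB Require Import structures.
From mathcomp Require Import all_boot all_order all_algebra.
From mathcomp Require Import all_classical all_reals all_analysis.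
Set Implicit Arguments. Unset Strict Implicit. Unset Printing Implicit Defensive.
Import Order.TTheory GRing.Theory Num.Theory.
Import numFieldNormedType.Exports.
Local Open Scope classical_set_scope.
Local Open Scope ring_scope.

Section Defs.
Variable R : realType.
Implicit Types (p dp q dq f df u du v dv y : R -> R) (lam x a : R).

Definition Rint (D : set R) f : R := \int[@lebesgue_measure R]_(x in D) f x.

Definition integrable_on (D : set R) f : Prop :=
  (@lebesgue_measure R).-integrable D (EFin \o f).

(* f is (locally) absolutely continuous on [a, +oo) with a.e. derivative df:
   f x = f a + \int_a^x df for every x >= a, df integrable on every [a,b]. *)
Definition ac_repr a f df : Prop :=
  (forall b, a <= b -> integrable_on `[a, b] df) /\
  (forall x, a <= x -> f x = f a + Rint `[a, x] df).

Definition assumptionA p dp q dq (x0 p0 : R) : Prop :=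
  [/\ [/\ (forall x, 0 <= x -> 0 < p x),
          ac_repr 0 p dp,
          integrable_on `[0, +oo[ dp,
          p x @[x --> +oo] --> p0 &
          0 < p0] &
      [/\ 0 < x0,
          integrable_on `[0, x0] q,
          ac_repr x0 q dq,
          integrable_on `[x0, +oo[ dq &
          q x @[x --> +oo] --> 0]].

Definition eps dp dq x : R := Rint `[x, +oo[ (fun t => `|dp t| + `|dq t|).

Definition ppart (A : R) : R := Num.max A 0.

Definition Phi p q lam x : R :=
  Rint `[0, x] (fun t => Num.sqrt (ppart ((lam - q t) / p t))).

Definition Kf p q lam : R :=
  expR (- Rint `[0, +oo[ (fun t => Num.sqrt (ppart ((q t - lam) / p t)))).

Definition amod p q lam x : R :=
  expR (- Rint `[0, x] (fun t => Num.sqrt (ppart ((q t - lam) / p t)))).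

(* a(x, lam + i0) (s = true) resp. a(x, lam - i0) (s = false), split into
   real and imaginary parts: a = |a| * exp(+- i Phi). *)
Definition a_re p q lam x : R := amod p q lam x * cos (Phi p q lam x).
Definition a_im p q (s : bool) lam x : R :=
  (if s then 1 else -1) * amod p q lam x * sin (Phi p q lam x).

(* y is a (Caratheodory) solution on [0,oo) of -(p y')' + q y = lam y with
   quasi-derivative y1 = p y':
   y x = y 0 + \int_0^x y1/p,  y1 x = y1 0 + \int_0^x (q - lam) y. *)
Definition sol_qd p q lam y (y1 : R -> R) : Prop :=
  forall x, 0 <= x ->
    [/\ integrable_on `[0, x] (fun t => y1 t / p t),
        integrable_on `[0, x] (fun t => (q t - lam) * y t),
        y x = y 0 + Rint `[0, x] (fun t => y1 t / p t) &
        y1 x = y1 0 + Rint `[0, x] (fun t => (q t - lam) * y t)].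

Definition is_sol p q lam y : Prop := exists y1, sol_qd p q lam y y1.

(* regular solution: phi(0) = 0, phi'(0) = 1 (i.e. (p phi')(0) = p(0)) *)
Definition is_regular p q lam y : Prop :=
  exists y1, [/\ sol_qd p q lam y y1, y 0 = 0 & y1 0 = p 0].

(* theta = tr + i ti is the modified Jost solution theta(., lam + i0)
   (s = true) or theta(., lam - i0) (s = false): a solution with
   theta = a (1 + O(eps)) as x -> oo, i.e. |theta - a| <= C eps |a|. *)
Definition is_jost p dp q dq lam (s : bool) (tr ti : R -> R) : Prop :=
  [/\ is_sol p q lam tr, is_sol p q lam ti &
      exists C X, forall x, X <= x ->
        Num.sqrt ((tr x - a_re p q lam x) ^+ 2 + (ti x - a_im p q s lam x) ^+ 2)
          <= C * eps dp dq x * amod p q lam x].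

Definition in_H10 u du : Prop :=
  [/\ (forall x, 0 <= x -> integrable_on `[0, x] du /\ u x = Rint `[0, x] du),
      integrable_on `[0, +oo[ (fun x => u x ^+ 2) &
      integrable_on `[0, +oo[ (fun x => du x ^+ 2)].

Definition bform p q u du v dv : R :=
  Rint `[0, +oo[ (fun x => p x * du x * dv x + q x * u x * v x).
Definition ip u v : R := Rint `[0, +oo[ (fun x => u x * v x).

(* lam is an eigenvalue of H (operator associated with the closed form t
   on H^1_0): exists f = fr + i fi in D(t), f <> 0 in L^2, with
   t[f, g] = lam (f, g) for all g = gr + i gi in D(t) (real and imaginary
   parts of the sesquilinear identity written out). *)
Definition is_eigenvalue p q lam : Prop :=
  exists fr dfr fi dfi,
    [/\ in_H10 fr dfr, in_H10 fi dfi,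
        ip fr fr + ip fi fi <> 0 &
        forall gr dgr gi dgi, in_H10 gr dgr -> in_H10 gi dgi ->
          bform p q fr dfr gr dgr + bform p q fi dfi gi dgi
            = lam * (ip fr gr + ip fi gi) /\
          bform p q fi dfi gr dgr - bform p q fr dfr gi dgi
            = lam * (ip fi gr - ip fr gi)].

End Defs.

(* Main.v *)
(** Only the Wronskian and an energy are used; no Jost solution is constructed.

    Let [theta = tr + i ti] be a Jost solution and [W] the constant Wronskian of
    [tr] and [ti].  The quantity [tr x * ti (x + h) - tr (x + h) * ti x] tends
    to [+- K^2 sin (sqrt (lam / p0) h)] as [x --> +oo], because [theta ~ a]; and it
    is [W * \int_x^(x + h) 1 / p + O(h^2)] uniformly in [x], because it solves the
    equation in [x + h] with value [0] and quasi-derivative [W] at [h = 0].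
    Letting [x --> +oo] and then [h --> 0] gives [W = +- sqrt (p0 lam) K^2].  In
    particular [theta 0 <> 0], and expanding [phi] on [tr] and [ti] by Cramer's
    rule yields the asymptotics of [phi] with no information on derivatives
    at infinity.

    An eigenfunction is a solution [u] with quasi-derivative [u1] (du
    Bois-Reymond).  The energy [E = u1^2 + p (lam - q) u^2] has derivative
    [(p (lam - q))' u^2], which is integrable relative to [E]; hence [E] stays
    bounded below by [E x / 2] beyond any large [x], and [u, u' \in L^2] forces
    [E x = 0].  Backward uniqueness then gives [u = 0]. *)

From HB Require Import structures.
From mathcomp Require Import all_boot all_order all_algebra.
From mathcomp Require Import all_classical all_reals all_analysis.
From mathcomp Require Import measurable_realfun ring lra.
Require Import Defs.
Import Order.TTheory GRing.Theory Num.Theory.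
Import numFieldNormedType.Exports.
Local Open Scope classical_set_scope.
Local Open Scope ring_scope.

(** * Integration on intervals *)

Section Integrals.
Context {R : realType}.
Implicit Types (f g df dg M : R -> R) (a b c x y : R).
Implicit Types D E : set (measurableTypeR R).
Notation mu := (@lebesgue_measure R).

Lemma integrable_on_sub D E f : measurable E -> measurable D -> D `<=` E ->
  integrable_on E f -> integrable_on D f.
Proof. by move=> mE mD DE; exact: integrableS. Qed.

Lemma integrable_on_itv_sub a b c d f : a <= c -> d <= b ->
  integrable_on `[a, b] f -> integrable_on `[c, d] f.
Proof.
move=> ac db; apply: integrable_on_sub => //.
by apply: subset_itv; rewrite bnd_simp.
Qed.

Lemma integrable_on_measurable D f : integrable_on D f -> measurable_fun D f.
Proof. by move=> /(measurable_int mu) /measurable_EFinP. Qed.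

Lemma integrable_on_eq D f g : measurable D -> (forall x, D x -> f x = g x) ->
  integrable_on D f -> integrable_on D g.
Proof.
move=> mD fg; apply: (@eq_integrable _ _ _ mu D mD (EFin \o f)).
by move=> x /set_mem Dx /=; rewrite fg.
Qed.

Lemma integrable_onD D f g : measurable D -> integrable_on D f ->
  integrable_on D g -> integrable_on D (fun x => f x + g x).
Proof. by move=> mD fi gi; apply: (integrableD mD fi gi). Qed.

Lemma integrable_onB D f g : measurable D -> integrable_on D f ->
  integrable_on D g -> integrable_on D (fun x => f x - g x).
Proof. by move=> mD fi gi; exact: (integrableB mD fi gi). Qed.

Lemma integrable_onZ D k f : measurable D -> integrable_on D f ->
  integrable_on D (fun x => k * f x).
Proof. by move=> mD fi; exact: (integrableZl mD k fi). Qed.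

Lemma integrable_on_norm D f : measurable D -> integrable_on D f ->
  integrable_on D (fun x => `|f x|).
Proof. by move=> mD; exact: integrable_norm. Qed.

Lemma integrable_on_le D f g : measurable D -> measurable_fun D f ->
  (forall x, D x -> `|f x| <= g x) -> integrable_on D g -> integrable_on D f.
Proof.
move=> mD mf fg; apply: (@le_integrable _ _ _ mu D mD (EFin \o f) (EFin \o g)) => //.
  exact/measurable_EFinP.
by move=> x Dx /=; rewrite lee_fin (le_trans (fg x Dx))// ler_norm.
Qed.

Lemma integrable_on_cst a b k : integrable_on `[a, b] (fun=> k).
Proof.
apply: (@continuous_compact_integrable R (fun=> k)); first exact: segment_compact.
by move=> x; exact: cvg_cst.
Qed.

Lemma integrable_onM D f g C : measurable D -> measurable_fun D g ->
  (forall x, D x -> `|g x| <= C) -> integrable_on D f ->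
  integrable_on D (fun x => f x * g x).
Proof.
move=> mD mg gC fi.
apply: (@integrable_on_le _ _ (fun x => C * `|f x|)) => //.
- by apply: measurable_funM => //; exact: integrable_on_measurable.
- by move=> x Dx; rewrite normrM mulrC ler_wpM2r// gC.
- exact/integrable_onZ/integrable_on_norm.
Qed.

Lemma eq_Rint D f g : (forall x, D x -> f x = g x) -> Rint D f = Rint D g.
Proof. by move=> fg; apply: eq_Rintegral => x /set_mem /fg. Qed.

Lemma RintD D f g : measurable D -> integrable_on D f -> integrable_on D g ->
  Rint D (fun x => f x + g x) = Rint D f + Rint D g.
Proof. by move=> mD fi gi; exact: RintegralD. Qed.

Lemma RintB D f g : measurable D -> integrable_on D f -> integrable_on D g ->
  Rint D (fun x => f x - g x) = Rint D f - Rint D g.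
Proof. by move=> mD fi gi; exact: RintegralB. Qed.

Lemma RintZ D k f : measurable D -> integrable_on D f ->
  Rint D (fun x => k * f x) = k * Rint D f.
Proof. by move=> mD fi; exact: RintegralZl. Qed.

Lemma le_Rint D f g : measurable D -> integrable_on D f -> integrable_on D g ->
  (forall x, D x -> f x <= g x) -> Rint D f <= Rint D g.
Proof. by move=> mD fi gi fg; exact: le_Rintegral. Qed.

Lemma Rint_ge0 D f : (forall x, D x -> 0 <= f x) -> 0 <= Rint D f.
Proof. by move=> f0; apply: Rintegral_ge0. Qed.

Lemma le_norm_Rint D f g : measurable D -> integrable_on D f ->
  integrable_on D g -> (forall x, D x -> `|f x| <= g x) ->
  `|Rint D f| <= Rint D g.
Proof.
move=> mD fi gi fg; apply: (le_trans (le_normr_Rintegral mD fi)).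
by apply: le_Rint => //; exact: integrable_on_norm.
Qed.

Lemma Rint_cst a b k : a <= b -> Rint `[a, b] (fun=> k) = k * (b - a).
Proof.
move=> ab; rewrite /Rint Rintegral_cst//= lebesgue_measure_itv/= lte_fin.
case: ltP => [|ba]; first by [].
by have -> : a = b; [apply/eqP; rewrite eq_le ab ba|rewrite subrr].
Qed.

Lemma Rint_cat a c b f : a <= c -> c <= b -> integrable_on `[a, b] f ->
  Rint `[a, b] f = Rint `[a, c] f + Rint `[c, b] f.
Proof.
move=> ac cb fi; rewrite /Rint.
rewrite -[X in _ = _ + X]Rintegral_itv_obnd_cbnd; last first.
  by apply: integrable_on_sub fi => //; apply: subset_itv; rewrite bnd_simp.
rewrite -(@Rintegral_itvB _ f _ _ c fi) ?bnd_simp//.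
by rewrite addrC subrK.
Qed.

Lemma Rint_cat_infty a c f : a <= c -> integrable_on `[a, +oo[ f ->
  Rint `[a, +oo[ f = Rint `[a, c] f + Rint `[c, +oo[ f.
Proof.
move=> ac fi; rewrite /Rint.
rewrite -[X in _ = _ + X]Rintegral_itv_obnd_cbnd; last first.
  by apply: integrable_on_sub fi => //; apply: subset_itv; rewrite bnd_simp.
rewrite -(@Rintegral_itvB _ f _ _ c fi) ?bnd_simp//.
by rewrite addrC subrK.
Qed.

Lemma Rint_itv1 a f : Rint `[a, a] f = 0.
Proof. by rewrite /Rint set_itv1 Rintegral_set1. Qed.

Lemma Rint_supp D E f : D `<=` E -> (forall x, E x -> ~ D x -> f x = 0) ->
  Rint E f = Rint D f.
Proof.
move=> DE f0; rewrite /Rint Rintegral_mkcond [RHS]Rintegral_mkcond.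
apply: eq_Rintegral => x _; rewrite !patchE.
case: ifPn => [/set_mem Ex|/negP nEx]; case: ifPn => [/set_mem Dx|/negP nDx] //.
- by apply: f0 => // Dx; apply: nDx; exact/mem_set.
- by exfalso; apply: nEx; apply/mem_set/DE.
Qed.

Lemma integrable_on_supp D E f : measurable D -> measurable E ->
  D `<=` E -> (forall x, E x -> ~ D x -> f x = 0) ->
  integrable_on D f -> integrable_on E f.
Proof.
move=> mD mE DE f0 fi.
apply/(integrable_mkcond _ mE).
have -> : (EFin \o f) \_ E = (EFin \o f) \_ D.
  apply/funext => x; rewrite !patchE.
  case: ifPn => [/set_mem Ex|/negP nEx]; case: ifPn => [/set_mem Dx|/negP nDx] //=.
  - by rewrite f0// => Dx; apply: nDx; exact/mem_set.
  - by exfalso; apply: nEx; apply/mem_set/DE.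
exact/(integrable_mkcond _ mD).
Qed.

Lemma continuous_itv_bounded a b f : {within `[a, b], continuous f} ->
  exists C, 0 <= C /\ forall x, a <= x -> x <= b -> `|f x| <= C.
Proof.
move=> cf; have [ab|ba] := leP a b; last first.
  by exists 0; split=> // x ax xb; move: (le_trans ax xb); rewrite leNgt ba.
have [c _ cM] := EVT_max ab cf; have [d _ dm] := EVT_min ab cf.
exists (`|f c| + `|f d|); split=> [|x ax xb]; first by rewrite addr_ge0.
have xab : x \in `[a, b] by rewrite in_itv/= ax.
have := cM _ xab; have := dm _ xab.
have := ler_norm (f c); have := ler_norm (- f d); rewrite normrN.
move=> *; rewrite ler_norml; apply/andP; split; last by have := normr_ge0 (f d); lra.
by have := normr_ge0 (f c); lra.
Qed.

Lemma continuous_itv_measurable a b f : {within `[a, b], continuous f} ->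
  measurable_fun (`[a, b] : set (measurableTypeR R)) f.
Proof. exact: subspace_continuous_measurable_fun. Qed.

(** By monotone convergence the integrals over [[a, a + n]] increase to the integral over the
    half-line, so the tail beyond some [a + N] is at most [e]. Since [f] is nonnegative, later tails
    are smaller still. *)
Lemma integrable_on_tail a f : (forall x, a <= x -> 0 <= f x) ->
  integrable_on `[a, +oo[ f ->
  forall e, 0 < e -> exists X, a <= X /\
    forall x, X <= x -> Rint `[x, +oo[ f <= e.
Proof.
move=> f0 fi e e0.
have cv : Rint `[a, a + n%:R] f @[n --> \oo] --> Rint `[a, +oo[ f.
  have U : \bigcup_n `[a, a + n%:R]%classic = `[a, +oo[%classic :> set R.
    apply/seteqP; split=> [x [n _ /=]|x /=]; rewrite !in_itv/=.
      by move=> /andP[-> _].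
    rewrite andbT => ax; exists (Num.bound (x - a)) => //=.
    by rewrite in_itv/= ax/= -lerBlDl ltW// archi_boundP// subr_ge0.
  apply: fine_cvg; rewrite fineK; last exact: integrable_fin_num.
  rewrite -U; apply: ge0_nondecreasing_set_cvg_integral => //.
  - move=> m n mn; apply/subsetPset; apply: subset_itvl.
    by rewrite bnd_simp lerD2l ler_nat.
  - move=> n; apply: measurable_int; apply: integrable_on_sub fi => //.
    by apply: subset_itvl; rewrite bnd_simp.
  - by move=> n x /=; rewrite in_itv/= lee_fin => /andP[ax _]; exact: f0.
have [N _ HN] := (cvgrPdist_le _ _).1 cv e e0.
have aN : a <= a + N%:R by rewrite lerDl.
exists (a + N%:R); split=> // x Nx.
have := HN N (leqnn N); rewrite /= (Rint_cat_infty _ (a + N%:R))//.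
rewrite addrAC subrr add0r; apply: le_trans; apply: le_trans (ler_norm _).
rewrite (Rint_cat_infty _ x) ?lerDr//; last first.
  by apply: integrable_on_sub fi => //; apply: subset_itvr; rewrite bnd_simp.
by apply: Rint_ge0 => t /=; rewrite in_itv/= => /andP[Nt _]; apply: f0; lra.
Qed.

End Integrals.

(** * Absolutely continuous functions *)

Section Bisection.
Context {R : realType}.
Implicit Types (F N M : R -> R) (a b x y : R).

(** A positive [d] would make [d * 2 ^+ n] unbounded, as [2 ^+ n] exceeds [n]. Every halving
    argument below ends this way. *)
Lemma le0_geometric (d K : R) : (forall n, d * 2 ^+ n <= K) -> d <= 0.
Proof.
move=> H; rewrite leNgt; apply/negP => d0.
have K0 : 0 <= K by have := H 0%N; rewrite expr0; lra.
have := archi_boundP (divr_ge0 K0 (ltW d0)); set n := Num.bound _.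
rewrite ltr_pdivrMr// => Kn.
have : n%:R * d <= d * 2 ^+ n.
  by rewrite mulrC ler_pM2l// -natrX ler_nat ltnW// ltn_expl.
by have := H n; lra.
Qed.

Lemma continuous_within_itv_sub F a b x y : a <= x -> y <= b ->
  {within `[a, b], continuous F} -> {within `[x, y], continuous F}.
Proof.
move=> ax yb; apply: continuous_subspaceW.
by apply: subset_itv; rewrite bnd_simp.
Qed.

Lemma midpoint_IVT M x y : x <= y -> {within `[x, y], continuous M} ->
  M x <= M y -> exists m, [/\ x <= m, m <= y & M m = (M x + M y) / 2].
Proof.
move=> xy cM Mxy.
have [|m] := @IVT R M x y ((M x + M y) / 2) xy cM.
  by rewrite min_l// max_r//; apply/andP; split; lra.
by rewrite in_itv/= => /andP[xm my] Mm; exists m.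
Qed.

(* Bisecting so that [M] is halved each time gains a factor [2] per step. *)
Lemma quadratic_increment_cst F M a b (C : R) : a <= b ->
  {within `[a, b], continuous M} ->
  (forall x y, a <= x -> x <= y -> y <= b -> M x <= M y) ->
  (forall x y, a <= x -> x <= y -> y <= b ->
     `|F y - F x| <= C * (M y - M x) ^+ 2) ->
  F b = F a.
Proof.
move=> ab cM Mnd FM.
have bis n x y : a <= x -> x <= y -> y <= b ->
    `|F y - F x| * 2 ^+ n <= C * (M y - M x) ^+ 2.
  elim: n x y => [|n IH] x y ax xy yb; first by rewrite expr0 mulr1; exact: FM.
  have [m [xm my Mm]] := midpoint_IVT _ _ _ xy
    (continuous_within_itv_sub _ _ _ _ _ ax yb cM) (Mnd _ _ ax xy yb).
  have H1 := IH _ _ ax xm (le_trans my yb).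
  have H2 := IH _ _ (le_trans ax xm) my yb.
  have tri : `|F y - F x| <= `|F y - F m| + `|F m - F x|.
    by have -> : F y - F x = (F y - F m) + (F m - F x); [ring|exact: ler_normD].
  have e0 : 0 <= (2 : R) ^+ n by exact: exprn_ge0.
  rewrite exprS; move: H1 H2; rewrite Mm => H1 H2.
  have := ler_wpM2r e0 tri; rewrite mulrDl; lra.
have : `|F b - F a| <= 0 by apply: le0_geometric => n; exact: bis.
by rewrite normr_le0 subr_eq0 => /eqP.
Qed.

(** A Gronwall argument run from right to left. Where [M] grows by at most [1 / 2], the hypothesis
    turns any bound on [N] into half that bound; starting from [B], this forces [N] to vanish. A
    longer interval is cut into such pieces by bisecting the range of [M]. *)
Lemma backward_vanishing N M a b (B : R) : a <= b ->
  {within `[a, b], continuous M} ->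
  (forall x y, a <= x -> x <= y -> y <= b -> M x <= M y) ->
  (forall x, a <= x -> x <= b -> 0 <= N x <= B) ->
  (forall x y L, a <= x -> x <= y -> y <= b -> N y = 0 ->
     (forall t, x <= t -> t <= y -> N t <= L) -> N x <= L * (M y - M x)) ->
  N b = 0 -> forall x, a <= x -> x <= b -> N x = 0.
Proof.
move=> ab cM Mnd NB NM.
have small x y : a <= x -> x <= y -> y <= b -> M y - M x <= 1 / 2 ->
    N y = 0 -> N x = 0.
  move=> ax xy yb Mxy Ny.
  have it n t : x <= t -> t <= y -> N t * 2 ^+ n <= B.
    elim: n t => [|n IH] t xt ty.
      by rewrite expr0 mulr1; have /andP[] := NB t ltac:(lra) ltac:(lra).
    have e0 : 0 < (2 : R) ^+ n by exact: exprn_gt0.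
    have B0 : 0 <= B.
      by have /andP[h1 h2] := NB t ltac:(lra) ltac:(lra); exact: le_trans h2.
    have h : N t <= B / 2 ^+ n * (M y - M t).
      apply: NM => //; [lra|move=> s ts sy].
      by rewrite ler_pdivlMr//; apply: IH => //; lra.
    have Mt : M y - M t <= 1 / 2.
      by have := Mnd x t ltac:(lra) ltac:(lra) ltac:(lra); lra.
    have h2 : N t <= B / 2 ^+ n * (1 / 2).
      by apply: (le_trans h); rewrite ler_wpM2l// divr_ge0// ltW.
    move: h2; rewrite mulrA ler_pdivlMr// mulr1 ler_pdivlMr// exprS; lra.
  have Nx0 : N x <= 0 by apply: le0_geometric => n; apply: it.
  by apply/eqP; rewrite eq_le Nx0/=; have /andP[] := NB x ltac:(lra) ltac:(lra).
(* Each induction step splits at the point where [M] takes its middle value: the right half carries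
   the zero from [y] to [m], the left half from [m] to [x]. *)
have large n x y : a <= x -> x <= y -> y <= b -> M y - M x <= 2 ^+ n / 2 ->
    N y = 0 -> N x = 0.
  elim: n x y => [|n IH] x y ax xy yb Mxy Ny.
    by apply: (small x y) => //; rewrite expr0 in Mxy.
  have [m [xm my Mm]] := midpoint_IVT _ _ _ xy
    (continuous_within_itv_sub _ _ _ _ _ ax yb cM) (Mnd _ _ ax xy yb).
  rewrite exprS in Mxy.
  apply: (IH x m) => //; [lra|lra|].
  by apply: (IH m y) => //; lra.
move=> Nb x ax xb.
pose n := Num.bound (2 * (M b - M x)).
have Mn : 2 * (M b - M x) < n%:R.
  by apply: archi_boundP; have := Mnd x b ax xb (lexx b); lra.
apply: (large n x b) => //.
have : n%:R <= (2 : R) ^+ n by rewrite -natrX ler_nat ltnW// ltn_expl.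
lra.
Qed.

End Bisection.

(** * Calculus of absolutely continuous functions, up to the product rule *)

Section AbsolutelyContinuous.
Context {R : realType}.
Implicit Types (f g df dg : R -> R) (a b c x y : R).

(** Absolute continuity is encoded by the integral identity with a chosen derivative, which avoids
    differentiation almost everywhere. The identity ranges over all subintervals, so that
    restriction is immediate. *)
Definition ac_on a b f df : Prop :=
  integrable_on `[a, b] df /\
  forall x y, a <= x -> x <= y -> y <= b -> f y = f x + Rint `[x, y] df.

Lemma ac_on_sub a b c d f df : a <= c -> d <= b -> ac_on a b f df ->
  ac_on c d f df.
Proof.
move=> ac db [dfi fE]; split; first exact: integrable_on_itv_sub dfi.
by move=> x y cx xy yd; apply: fE => //; lra.
Qed.

Lemma ac_on_integrable a b f df : ac_on a b f df ->
  forall x y, a <= x -> y <= b -> integrable_on `[x, y] df.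
Proof. by move=> [dfi _] x y ax yb; exact: integrable_on_itv_sub dfi. Qed.

Lemma ac_on_eq a b f g df dg : (forall x, a <= x -> x <= b -> f x = g x) ->
  (forall x, a <= x -> x <= b -> df x = dg x) ->
  ac_on a b f df -> ac_on a b g dg.
Proof.
move=> fg dfg [dfi fE]; split.
  apply: integrable_on_eq dfi => // x /=; rewrite in_itv/= => /andP[? ?].
  exact: dfg.
move=> x y ax xy yb; rewrite -!fg; [|lra..]; rewrite (fE x y)//; congr (_ + _).
by apply: eq_Rint => t /=; rewrite in_itv/= => /andP[? ?]; apply: dfg; lra.
Qed.

Lemma ac_on_Rint a b f : integrable_on `[a, b] f ->
  ac_on a b (fun x => Rint `[a, x] f) f.
Proof.
move=> fi; split=> // x y ax xy yb; apply: Rint_cat => //.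
by apply: integrable_on_itv_sub fi.
Qed.

Lemma ac_on_from a b f df : integrable_on `[a, b] df ->
  (forall x, a <= x -> x <= b -> f x = f a + Rint `[a, x] df) -> ac_on a b f df.
Proof.
move=> dfi fE; split=> // x y ax xy yb.
rewrite (fE x) ?(fE y)//; [|lra..]; rewrite -addrA; congr (_ + _).
by apply: Rint_cat => //; apply: integrable_on_itv_sub dfi.
Qed.

Lemma ac_repr_ac_on a b f df : ac_repr a f df -> ac_on a b f df.
Proof.
move=> [dfi fE]; have [ab|ba] := leP a b.
  by apply: ac_on_from => [|x ax _]; [exact: dfi|exact: fE].
split=> [|x y ax xy yb]; last by exfalso; lra.
by apply: integrable_on_itv_sub (dfi a (lexx a)) => //; exact: ltW.
Qed.

Lemma ac_on_continuous a b f df : ac_on a b f df ->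
  {within `[a, b], continuous f}.
Proof.
move=> [dfi fE]; have [ab|ba] := leP a b; last first.
  by rewrite set_itv_ge ?bnd_simp -?ltNge//; exact: continuous_subspace0.
have c0 := parameterized_integral_continuous ab dfi.
have : {within `[a, b], continuous (fun x => f a + Rint `[a, x] df)}.
  by move=> x; apply: cvgD; [exact: cvg_cst|exact: c0].
apply: subspace_eq_continuous => x /set_mem /=; rewrite in_itv/= => /andP[ax xb].
by rewrite /from_subspace /= (fE a x).
Qed.

Lemma ac_on_bounded a b f df : ac_on a b f df ->
  exists C, 0 <= C /\ forall x, a <= x -> x <= b -> `|f x| <= C.
Proof. by move=> /ac_on_continuous; exact: continuous_itv_bounded. Qed.

Lemma ac_on_measurable a b f df : ac_on a b f df ->
  measurable_fun (`[a, b] : set (measurableTypeR R)) f.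
Proof. by move=> /ac_on_continuous; exact: continuous_itv_measurable. Qed.

Lemma integrable_on_acM a b f g dg : integrable_on `[a, b] f ->
  ac_on a b g dg -> integrable_on `[a, b] (fun x => f x * g x).
Proof.
move=> fi gac; have [C [_ gC]] := ac_on_bounded _ _ _ _ gac.
apply: (integrable_onM _ _ _ C) => //; first exact: ac_on_measurable gac.
by move=> x /=; rewrite in_itv/= => /andP[]; exact: gC.
Qed.

Lemma integrable_on_ac a b f df : ac_on a b f df -> integrable_on `[a, b] f.
Proof.
move=> fac; apply: (@integrable_on_eq _ _ (fun x => 1 * f x)) => //.
  by move=> x _; rewrite mul1r.
exact: integrable_on_acM (integrable_on_cst _ _ _) fac.
Qed.

Lemma ac_on_cst a b k : ac_on a b (fun=> k) (fun=> 0).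
Proof.
split=> [|x y _ xy _]; first exact: integrable_on_cst.
by rewrite Rint_cst// mul0r addr0.
Qed.

Lemma ac_onD a b f g df dg : ac_on a b f df -> ac_on a b g dg ->
  ac_on a b (fun x => f x + g x) (fun x => df x + dg x).
Proof.
move=> [dfi fE] [dgi gE]; split=> [|x y ax xy yb]; first exact: integrable_onD.
rewrite (fE x y)// (gE x y)// RintD//; first by ring.
- exact: integrable_on_itv_sub dfi.
- exact: integrable_on_itv_sub dgi.
Qed.

Lemma ac_onZ a b k f df : ac_on a b f df ->
  ac_on a b (fun x => k * f x) (fun x => k * df x).
Proof.
move=> [dfi fE]; split=> [|x y ax xy yb]; first exact: integrable_onZ.
rewrite (fE x y)// RintZ//; first by ring.
exact: integrable_on_itv_sub dfi.
Qed.

Lemma ac_onB a b f g df dg : ac_on a b f df -> ac_on a b g dg ->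
  ac_on a b (fun x => f x - g x) (fun x => df x - dg x).
Proof.
move=> fac gac; have := ac_onD _ _ _ _ _ _ fac (ac_onZ _ _ (-1) _ _ gac).
by apply: ac_on_eq => x _ _; ring.
Qed.

(** With [M] the primitive of [|df| + |dg|], the difference [F] between [f g] and the proposed
    primitive changes by at most [2 (M y - M x)^2] over [[x, y]]; bisection then makes it
    constant. *)
Lemma ac_onM a b f g df dg : ac_on a b f df -> ac_on a b g dg ->
  ac_on a b (fun x => f x * g x) (fun x => df x * g x + dg x * f x).
Proof.
move=> fac gac; have [dfi fE] := fac; have [dgi gE] := gac.
have Hi : integrable_on `[a, b] (fun x => df x * g x + dg x * f x).
  apply: integrable_onD => //.
  - exact: integrable_on_acM gac.
  - exact: integrable_on_acM fac.
apply: ac_on_from => // z az zb.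
pose m x := `|df x| + `|dg x|.
have mi : integrable_on `[a, b] m.
  by apply: integrable_onD => //; exact: integrable_on_norm.
pose M x := Rint `[a, x] m.
have Mac : ac_on a b M m by exact: ac_on_Rint.
have MB x y : a <= x -> x <= y -> y <= b -> Rint `[x, y] m = M y - M x.
  by move=> ax xy yb; rewrite (Mac.2 x y)//; ring.
have m0 x : 0 <= m x by rewrite addr_ge0.
have Mnd x y : a <= x -> x <= y -> y <= b -> M x <= M y.
  by move=> ax xy yb; rewrite -subr_ge0 -MB//; apply: Rint_ge0 => t _.
have inc h dh x y : (forall t, `|dh t| <= m t) -> ac_on a b h dh ->
    a <= x -> x <= y -> y <= b -> `|h y - h x| <= M y - M x.
  move=> dhm hac ax xy yb; rewrite (hac.2 x y)// addrAC subrr add0r -MB//.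
  apply: le_norm_Rint => //; first exact: ac_on_integrable hac _ _ _ _.
  exact: ac_on_integrable Mac _ _ _ _.
have dfm t : `|df t| <= m t by rewrite lerDl.
have dgm t : `|dg t| <= m t by rewrite lerDr.
(* The increments of [F] are quadratic in those of [M]. *)
pose F x := f x * g x - Rint `[a, x] (fun t => df t * g t + dg t * f t).
suff : F z = F a by rewrite /F Rint_itv1 subr0 => <-; rewrite subrK.
apply: (@quadratic_increment_cst _ F M a z 2) => //.
- exact: continuous_within_itv_sub (ac_on_continuous _ _ _ _ Mac).
- by move=> x y ax xy yz; apply: Mnd => //; lra.
move=> x y ax xy yz; have yb : y <= b by lra.
have dfxy : integrable_on `[x, y] df by exact: ac_on_integrable fac _ _ _ _.
have dgxy : integrable_on `[x, y] dg by exact: ac_on_integrable gac _ _ _ _.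
have mxy : integrable_on `[x, y] m by exact: ac_on_integrable Mac _ _ _ _.
have Hxy : integrable_on `[x, y] (fun x => df x * g x + dg x * f x).
  exact: integrable_on_itv_sub Hi.
have i1 : integrable_on `[x, y] (fun t => g y * df t + f x * dg t).
  by apply: integrable_onD => //; exact: integrable_onZ.
have -> : F y - F x = Rint `[x, y]
    (fun t => (g y * df t + f x * dg t) - (df t * g t + dg t * f t)).
  rewrite RintB// RintD//; try exact: integrable_onZ.
  rewrite !RintZ// /F ((ac_on_Rint _ _ _ Hi).2 x y)//.
  by rewrite (fE x y)// (gE x y)//; ring.
have -> : 2 * (M y - M x) ^+ 2
    = Rint `[x, y] (fun t => 2 * (M y - M x) * m t).
  by rewrite RintZ// MB//; ring.
apply: le_norm_Rint => //; first exact: integrable_onB.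
  exact: integrable_onZ.
move=> t /=; rewrite in_itv/= => /andP[xt ty].
(* Each term is now an increment of [f] or [g], at most [M y - M x], times a derivative bounded by
   [m t]; integrating [m] supplies the second factor [M y - M x]. *)
have -> : g y * df t + f x * dg t - (df t * g t + dg t * f t) =
  (g y - g t) * df t - (f t - f x) * dg t by ring.
have h1 : `|g y - g t| <= M y - M x.
  apply: le_trans (inc g dg t y dgm gac _ _ _) _; [lra..|].
  by rewrite lerD2l lerN2; apply: Mnd; lra.
have h2 : `|f t - f x| <= M y - M x.
  apply: le_trans (inc f df x t dfm fac _ _ _) _; [lra..|].
  by rewrite lerD2r; apply: Mnd; lra.
apply: le_trans (ler_normB _ _) _; rewrite !normrM.
have := ler_pM (normr_ge0 _) (normr_ge0 _) h1 (dfm t).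
have := ler_pM (normr_ge0 _) (normr_ge0 _) h2 (dgm t).
lra.
Qed.

End AbsolutelyContinuous.

(** * Elementary estimates for limits, square roots, sines and short integrals *)

Section RealFunctions.
Context {R : realType}.
Implicit Types (f : R -> R) (a b c x y h l e : R).

Lemma integrable_onU (D E : set (measurableTypeR R)) f :
  measurable D -> measurable E ->
  integrable_on D f -> integrable_on E f -> integrable_on (D `|` E) f.
Proof.
move=> mD mE fD fE.
have mU : measurable (D `|` E) by exact: measurableU.
have mED : measurable (E `\` D) by exact: measurableD.
have pieceI (S : set (measurableTypeR R)) : measurable S -> S `<=` D `|` E ->
    integrable_on S f -> integrable_on (D `|` E) (f \_ S).
  move=> mS SU fS; apply: (@integrable_on_supp _ S) => //.
    by move=> x _ nS; rewrite patchE memNset.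
  by apply: integrable_on_eq fS => // x Sx; rewrite patchE mem_set.
have ED : E `\` D `<=` D `|` E by move=> x []; right.
have := @integrable_onD _ _ (f \_ D) (f \_ (E `\` D)) mU
  (pieceI D mD (@subsetUl _ _ _) fD)
  (pieceI _ mED ED (integrable_on_sub _ _ _ mE mED (@subDsetl _ _ _) fE)).
apply: integrable_on_eq => // x [Dx|Ex]; rewrite !patchE.
  by rewrite mem_set// memNset ?addr0// => -[].
have [Dx|nDx] := pselect (D x).
  by rewrite mem_set// memNset ?addr0// => -[].
by rewrite memNset// mem_set// add0r.
Qed.

Lemma cvg_pinfty_le f l : f x @[x --> +oo] --> l ->
  forall e, 0 < e -> exists X, forall x, X <= x -> `|f x - l| <= e.
Proof.
move=> /cvgrPdist_le fl e e0.
have [M [_ HM]] := fl e e0; exists (M + 1) => x Mx.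
by rewrite distrC; apply: HM; lra.
Qed.

(** [Num.sqrt] is [0] on negative reals, so it already takes the positive part. *)
Lemma sqrt_ppart (A : R) : Num.sqrt (ppart A) = Num.sqrt A.
Proof.
rewrite /ppart; have [A0|//] := leP A 0.
by rewrite sqrtr0 (ler0_sqrtr A0).
Qed.

Lemma sqrt_le1D (A : R) : Num.sqrt A <= 1 + `|A|.
Proof.
have h : A <= (1 + `|A|) ^+ 2.
  have := ler_norm A; have := normr_ge0 A; have := sqr_ge0 `|A|; nra.
by apply: le_trans (ler_wsqrtr h) _; rewrite sqrtr_sqr ger0_norm// addr_ge0.
Qed.

Lemma sin_lipschitz x y : `|sin x - sin y| <= `|x - y|.
Proof.
wlog xy : x y / y <= x.
  move=> H; have [|/ltW] := leP y x; first exact: H.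
  by move=> /H; rewrite distrC (distrC y).
have cs : {within `[y, x], continuous (@sin R)}.
  by apply: continuous_subspaceT; exact: continuous_sin.
have [c _ ->] := MVT_segment xy (fun z _ => is_derive_sin z) cs.
by rewrite normrM ler_piMl// ler_norml cos_geN1 cos_le1.
Qed.

(** The mean value theorem is applied to the sine and then to the cosine. A quadratic error is
    enough for the limit of small steps. *)
Lemma sin_near0 x : 0 <= x -> `|sin x - x| <= x ^+ 2.
Proof.
move=> x0; have cs : {within `[0, x], continuous (@sin R)}.
  by apply: continuous_subspaceT; exact: continuous_sin.
have [c] := MVT_segment x0 (fun z _ => is_derive_sin z) cs.
rewrite in_itv/= => /andP[c0 cx]; rewrite sin0 !subr0 => ->.
have cc : {within `[0, c], continuous (@cos R)}.
  by apply: continuous_subspaceT; exact: continuous_cos.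
have [d _] := MVT_segment c0 (fun z _ => is_derive_cos z) cc.
rewrite cos0 subr0 => cE.
have -> : cos c * x - x = (cos c - 1) * x by ring.
rewrite cE normrM (ger0_norm x0) expr2 ler_wpM2r// normrM normrN (ger0_norm c0).
apply: le_trans cx; rewrite ler_piMl// ler_norml sin_geN1 sin_le1//.
Qed.

Lemma Rint_near_cst f a h l e : 0 <= h -> integrable_on `[a, a + h] f ->
  (forall t, a <= t -> t <= a + h -> `|f t - l| <= e) ->
  `|Rint `[a, a + h] f - l * h| <= e * h.
Proof.
move=> h0 fi fl; have ah : a <= a + h by lra.
have -> : l * h = Rint `[a, a + h] (fun=> l) by rewrite Rint_cst//; ring.
have -> : e * h = Rint `[a, a + h] (fun=> e) by rewrite Rint_cst//; ring.
rewrite -RintB//; last exact: integrable_on_cst.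
apply: le_norm_Rint => //; last by move=> t /=; rewrite in_itv/= => /andP[]; exact: fl.
- by apply: integrable_onB => //; exact: integrable_on_cst.
- exact: integrable_on_cst.
Qed.

End RealFunctions.

(** * The coefficients under Assumption A: local integrability and behaviour at infinity *)

Section Coefficients.
Context {R : realType} {p dp q dq : R -> R} {x0 p0 : R}.
Context (hA : assumptionA p dp q dq x0 p0).
Implicit Types (lam x b e : R).

Lemma p_gt0 x : 0 <= x -> 0 < p x.
Proof. by case: hA => -[pp _ _ _ _] _; exact: pp. Qed.

Lemma p0_gt0 : 0 < p0.
Proof. by case: hA => -[]. Qed.

Lemma p_ac b : ac_on 0 b p dp.
Proof. by case: hA => -[_ + _ _ _] _; exact: ac_repr_ac_on. Qed.

Lemma pV_continuous b : {within `[0, b], continuous (fun x => (p x)^-1)}.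
Proof.
have cp := ac_on_continuous _ _ _ _ (p_ac b).
apply/subspace_continuousP => x xb; apply: cvgV.
  by move: xb => /=; rewrite in_itv/= => /andP[x0' _]; rewrite gt_eqF// p_gt0.
by move/subspace_continuousP : cp; exact.
Qed.

Lemma integrable_pV b : integrable_on `[0, b] (fun x => (p x)^-1).
Proof.
apply: (@continuous_compact_integrable R (fun x => (p x)^-1)).
  exact: segment_compact.
exact: pV_continuous.
Qed.

Lemma integrable_divp b (f : R -> R) : integrable_on `[0, b] f ->
  integrable_on `[0, b] (fun x => f x / p x).
Proof.
have [C [_ HC]] := continuous_itv_bounded _ _ _ (pV_continuous b).
apply: (integrable_onM _ _ _ C) => //.
  by apply: continuous_itv_measurable; exact: pV_continuous.
by move=> x /=; rewrite in_itv/= => /andP[]; exact: HC.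
Qed.

Lemma q_ac b : ac_on x0 b q dq.
Proof. by case: hA => _ [_ _ + _ _]; exact: ac_repr_ac_on. Qed.

Lemma integrable_q b : integrable_on `[0, b] q.
Proof.
have [x00 qi] : 0 < x0 /\ integrable_on `[0, x0] q by case: hA => _ [].
have := integrable_onU _ _ _ _ _ qi (integrable_on_ac _ _ _ _ (q_ac b)).
move=> /(_ _ _)/integrable_on_sub; apply => //; first exact: measurableU.
move=> x /=; rewrite !in_itv/= => /andP[x0' xb].
by have [h|/ltW h] := leP x x0; [left|right]; rewrite ?x0' ?h ?xb.
Qed.

Lemma p_cvg e : 0 < e -> exists X, forall x, X <= x -> `|p x - p0| <= e.
Proof. by case: hA => -[_ _ _ pc _] _; exact: cvg_pinfty_le pc e. Qed.

Lemma q_cvg e : 0 < e -> exists X, forall x, X <= x -> `|q x| <= e.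
Proof.
case: hA => _ [_ _ _ _ q0] e0.
have [X HX] := cvg_pinfty_le _ _ q0 e e0; exists X => x /HX.
by rewrite subr0.
Qed.

(** On a bounded interval the square root of an integrable function [A] is dominated by the
    integrable function [1 + |A|]. *)
Lemma integrable_sqrt_quot b lam (k : R) :
  integrable_on `[0, b] (fun t => Num.sqrt (ppart ((k * (lam - q t)) / p t))).
Proof.
have Ai : integrable_on `[0, b] (fun t => (k * (lam - q t)) / p t).
  apply: integrable_divp; apply: integrable_onZ => //; apply: integrable_onB => //.
    exact: integrable_on_cst.
  exact: integrable_q.
apply: (@integrable_on_eq _ _ (fun t => Num.sqrt ((k * (lam - q t)) / p t))) => //.
  by move=> x _; rewrite sqrt_ppart.
apply: (@integrable_on_le _ _ _ (fun t => 1 + `|(k * (lam - q t)) / p t|)) => //.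
- apply: (@measurableT_comp _ _ _ _ _ _ (@Num.sqrt R)).
    by apply: continuous_measurable_fun; exact: sqrt_continuous.
  exact: integrable_on_measurable.
- by move=> x _; rewrite ger0_norm ?sqrtr_ge0//; exact: sqrt_le1D.
- by apply: integrable_onD; [|exact: integrable_on_cst|exact: integrable_on_norm].
Qed.

Lemma Phi_increment lam x h : 0 <= x -> 0 <= h ->
  integrable_on `[x, x + h] (fun t => Num.sqrt ((lam - q t) / p t)) /\
  Phi p q lam (x + h) - Phi p q lam x =
    Rint `[x, x + h] (fun t => Num.sqrt ((lam - q t) / p t)).
Proof.
move=> xge h0.
have hi : integrable_on `[0, x + h] (fun t => Num.sqrt (ppart ((lam - q t) / p t))).
  apply: integrable_on_eq (integrable_sqrt_quot (x + h) lam 1) => // t _.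
  by rewrite mul1r.
have [_ H] := ac_on_Rint _ _ _ hi.
split.
  have := integrable_on_itv_sub _ _ _ _ _ xge (lexx (x + h)) hi.
  by apply: integrable_on_eq => // t _; rewrite sqrt_ppart.
rewrite /Phi (H x (x + h))//; last by lra.
by rewrite addrAC subrr add0r; apply: eq_Rint => t _; rewrite sqrt_ppart.
Qed.

Lemma sqrt_quot_cvg lam e : 0 < e -> exists X, forall x, X <= x ->
  `|Num.sqrt ((lam - q x) / p x) - Num.sqrt (lam / p0)| <= e.
Proof.
case: hA => -[_ _ _ pc p0p] [_ _ _ _ qc]; move: e.
apply: (@cvg_pinfty_le _ (fun x => Num.sqrt ((lam - q x) / p x))).
apply: (@cvg_comp _ _ _ (fun x => (lam - q x) / p x) (@Num.sqrt R) _
  (nbhs (lam / p0))); last exact: sqrt_continuous.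
apply: cvgM; last by apply: cvgV => //; rewrite gt_eqF.
by rewrite -[X in _ --> X]subr0; apply: cvgB => //; exact: cvg_cst.
Qed.

(** As [q] tends to [0], the integrand in the exponent vanishes beyond some point. The modulus of
    [a] is therefore exactly [K] from there on, not only in the limit. *)
Lemma amod_eventually lam : 0 < lam ->
  exists X, 0 <= X /\ forall x, X <= x -> amod p q lam x = Kf p q lam.
Proof.
move=> lam0; have [X HX] := q_cvg _ lam0.
exists (Num.max 0 X); split=> [|x]; first by rewrite le_max lexx.
rewrite ge_max => /andP[x0' Xx]; rewrite /amod /Kf; congr (expR (- _)).
apply/esym/Rint_supp.
  by apply: subset_itvl; rewrite bnd_simp.
move=> t /=; rewrite !in_itv/= andbT => t0 /negP; rewrite t0/= -ltNge => xt.
rewrite sqrt_ppart ler0_sqrtr// pmulr_lle0 ?invr_gt0 ?p_gt0//.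
have := HX t ltac:(lra); have := ler_norm (q t); lra.
Qed.

Lemma integrable_variation x : x0 <= x ->
  integrable_on `[x, +oo[ (fun t => `|dp t| + `|dq t|).
Proof.
case: hA => -[_ _ dpi _ _] [x0p _ _ dqi _] xx0.
apply: integrable_onD => //; apply: integrable_on_norm => //.
  by apply: integrable_on_sub dpi => //; apply: subset_itvr; rewrite bnd_simp; lra.
by apply: integrable_on_sub dqi => //; apply: subset_itvr; rewrite bnd_simp.
Qed.

Lemma eps_cvg e : 0 < e -> exists X, forall x, X <= x -> eps dp dq x <= e.
Proof.
move=> e0.
have vi := integrable_variation x0 (lexx x0).
have [x _|X [_ HX]] := integrable_on_tail _ _ _ vi e e0.
  by rewrite addr_ge0.
by exists X.
Qed.

Lemma Kf_gt0 lam : 0 < Kf p q lam.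
Proof. exact: expR_gt0. Qed.

End Coefficients.

(** * The Wronskian of a Jost solution *)

Section Solutions.
Context {R : realType} {p dp q dq : R -> R} {x0 p0 : R}.
Context (hA : assumptionA p dp q dq x0 p0).
Implicit Types (lam x b e h : R) (y z tr ti : R -> R).

Lemma sol_qd_ac lam y y1 b : 0 <= b -> sol_qd p q lam y y1 ->
  ac_on 0 b y (fun t => y1 t / p t) /\
  ac_on 0 b y1 (fun t => (q t - lam) * y t).
Proof.
move=> b0 ys; have [i1 i2 _ _] := ys b b0.
by split; apply: ac_on_from => // x xge _; have [] := ys x xge.
Qed.

Lemma sol_qd_comb lam y y1 z z1 (k l : R) :
  sol_qd p q lam y y1 -> sol_qd p q lam z z1 ->
  sol_qd p q lam (fun t => k * y t + l * z t) (fun t => k * y1 t + l * z1 t).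
Proof.
move=> ys zs x xge.
have [yac y1ac] := sol_qd_ac _ _ _ _ xge ys.
have [zac z1ac] := sol_qd_ac _ _ _ _ xge zs.
have h1 := ac_onD _ _ _ _ _ _ (ac_onZ _ _ k _ _ yac) (ac_onZ _ _ l _ _ zac).
have h2 := ac_onD _ _ _ _ _ _ (ac_onZ _ _ k _ _ y1ac) (ac_onZ _ _ l _ _ z1ac).
have {}h1 : ac_on 0 x (fun t => k * y t + l * z t)
    (fun t => (k * y1 t + l * z1 t) / p t).
  by apply: ac_on_eq h1 => t _ _ //; ring.
have {}h2 : ac_on 0 x (fun t => k * y1 t + l * z1 t)
    (fun t => (q t - lam) * (k * y t + l * z t)).
  by apply: ac_on_eq h2 => t _ _ //; ring.
split; [exact: h1.1|exact: h2.1|exact: h1.2|exact: h2.2].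
Qed.

(** By the product rule the Wronskian has derivative [y1 z1 / p + (q - lam) z y - (q - lam) y z -
    (z1 / p) y1], which cancels pointwise. *)
Lemma wronskian_cst lam y y1 z z1 x : 0 <= x ->
  sol_qd p q lam y y1 -> sol_qd p q lam z z1 ->
  y x * z1 x - y1 x * z x = y 0 * z1 0 - y1 0 * z 0.
Proof.
move=> xge ys zs.
have [yac y1ac] := sol_qd_ac _ _ _ _ xge ys.
have [zac z1ac] := sol_qd_ac _ _ _ _ xge zs.
have := ac_onB _ _ _ _ _ _ (ac_onM _ _ _ _ _ _ yac z1ac)
  (ac_onM _ _ _ _ _ _ y1ac zac).
move=> [_ /(_ 0 x (lexx _) xge (lexx _)) ->].
rewrite -[RHS]addr0; congr (_ + _).
rewrite (@eq_Rint _ _ _ (fun=> 0)) ?Rint_cst ?mul0r// => t _; ring.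
Qed.

Lemma pV_cvg e : 0 < e -> exists X, forall x, X <= x -> `|(p x)^-1 - p0^-1| <= e.
Proof.
apply: (@cvg_pinfty_le _ (fun x => (p x)^-1)).
by case: hA => -[_ _ _ pc p0p] _; apply: cvgV => //; rewrite gt_eqF.
Qed.

Lemma pV_le : exists X, forall x, X <= x -> 0 < (p x)^-1 <= 2 / p0.
Proof.
have p0p := p0_gt0 hA; have ip : 0 < p0^-1 by rewrite invr_gt0.
have [|X HX] := pV_cvg (p0^-1 / 2); first by lra.
exists X => x /HX; rewrite ler_norml => /andP[h1 h2].
by apply/andP; split; lra.
Qed.

(** Since [z x = 0], the value [z (x + h)] is the integral of [z1 / p], and [z1] moves by at most
    [L Z h] on the interval. The error depends on [x] only through the bounds [P], [L], [Z], hence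
    can be kept uniform as [x] grows. *)
Lemma solution_taylor lam z z1 x h (P L Z : R) : 0 <= x -> 0 <= h ->
  sol_qd p q lam z z1 -> z x = 0 ->
  (forall t, x <= t -> t <= x + h ->
    [/\ 0 <= (p t)^-1 <= P, `|q t - lam| <= L & `|z t| <= Z]) ->
  `|z (x + h) - z1 x * Rint `[x, x + h] (fun t => (p t)^-1)|
    <= P * L * Z * h ^+ 2.
Proof.
move=> xge h0 zs zx H; have xh : 0 <= x + h by lra.
have [zac z1ac] := sol_qd_ac _ _ _ _ xh zs.
have pVi : integrable_on `[x, x + h] (fun t => (p t)^-1).
  exact: integrable_on_itv_sub (integrable_pV hA (x + h)).
have [Px Lx Zx] := H x (lexx x) ltac:(lra).
have P0 : 0 <= P by case/andP: Px => ?; exact: le_trans.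
have L0 : 0 <= L by exact: le_trans Lx.
have Z0 : 0 <= Z by exact: le_trans Zx.
have z1x t : x <= t -> t <= x + h -> `|z1 t - z1 x| <= L * Z * h.
  move=> xt th; rewrite (z1ac.2 x t)// addrAC subrr add0r.
  apply: (@le_trans _ _ (Rint `[x, t] (fun=> L * Z))).
    apply: le_norm_Rint => //.
    - exact: ac_on_integrable z1ac _ _ _ _.
    - exact: integrable_on_cst.
    - move=> s /=; rewrite in_itv/= => /andP[xs st]; rewrite normrM.
      by have [_ hL hZ] := H s xs ltac:(lra); exact: ler_pM.
  by rewrite Rint_cst// ler_wpM2l ?mulr_ge0//; lra.
rewrite (zac.2 x (x + h))//; last lra.
rewrite zx add0r -RintZ//.
rewrite -RintB//; last 2 first.
- exact: ac_on_integrable zac _ _ _ _.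
- exact: integrable_onZ.
have -> : P * L * Z * h ^+ 2 = Rint `[x, x + h] (fun=> P * (L * Z * h)).
  by rewrite Rint_cst; [ring|lra].
apply: le_norm_Rint => //.
- apply: integrable_onB => //; last exact: integrable_onZ.
  exact: ac_on_integrable zac _ _ _ _.
- exact: integrable_on_cst.
move=> t /=; rewrite in_itv/= => /andP[xt th].
have [/andP[pt0 ptP] _ _] := H t xt th.
rewrite -mulrBl normrM mulrC (ger0_norm pt0).
by apply: ler_pM => //; exact: z1x.
Qed.

Lemma le_sqrt_sumsq (u v : R) :
  `|u| <= Num.sqrt (u ^+ 2 + v ^+ 2) /\ `|v| <= Num.sqrt (u ^+ 2 + v ^+ 2).
Proof.
by split; rewrite -sqrtr_sqr ler_wsqrtr// ?lerDl ?lerDr sqr_ge0.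
Qed.

(** The relative error [C * eps] tends to [0], and the modulus of [a] is eventually the constant
    [K]; together they give absolute closeness to [K e^{i Phi}] or its conjugate. *)
Lemma jost_close lam s tr ti e : 0 < lam -> is_jost p dp q dq lam s tr ti ->
  0 < e -> exists X, forall x, X <= x ->
    `|tr x - Kf p q lam * cos (Phi p q lam x)| <= e /\
    `|ti x - (if s then 1 else -1) * Kf p q lam * sin (Phi p q lam x)| <= e.
Proof.
move=> lam0 [_ _ [C [X HX]]] e0.
have [Y [_ HY]] := amod_eventually hA _ lam0.
have K0 := @Kf_gt0 _ p q lam.
(* The sign of [C] is unknown and [C] may be [0]; the added [1] keeps the divisor positive. *)
have D0 : 0 < `|C| * Kf p q lam + 1.
  by rewrite ltr_wpDl// mulr_ge0// ltW.
have [Z HZ] := eps_cvg hA _ (divr_gt0 e0 D0).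
exists (Num.max X (Num.max Y Z)) => x; rewrite !ge_max => /and3P[Xx Yx Zx].
have := HX x Xx; rewrite /a_re /a_im HY//; have := HZ x Zx.
rewrite ler_pdivlMr//; set u := tr x - _; set v := ti x - _ => he hs.
have eps0 : 0 <= eps dp dq x by apply: Rint_ge0 => t _; rewrite addr_ge0.
have hC : C * eps dp dq x * Kf p q lam <= e.
  apply: le_trans he; rewrite mulrDr mulr1.
  have : C * (eps dp dq x * Kf p q lam) <= `|C| * (eps dp dq x * Kf p q lam).
    by rewrite ler_wpM2r ?ler_norm// mulr_ge0// ltW.
  lra.
have [h1 h2] := le_sqrt_sumsq u v.
by split; [apply: le_trans h1 _|apply: le_trans h2 _]; apply: le_trans hs hC.
Qed.

(** First of the two limits: [x] goes to infinity with [h] fixed. The left side does not contain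
    [x], so every error that vanishes at infinity disappears and only the quadratic Taylor error
    remains. *)
Lemma jost_wronskian_small_step lam s tr tr1 ti ti1 :
  0 < lam -> sol_qd p q lam tr tr1 -> sol_qd p q lam ti ti1 ->
  is_jost p dp q dq lam s tr ti ->
  let K := Kf p q lam in
  let W := tr 0 * ti1 0 - tr1 0 * ti 0 in
  exists C, forall h, 0 < h -> h <= 1 ->
    `|(if s then 1 else -1) * K ^+ 2 * sin (Num.sqrt (lam / p0) * h) - W * h / p0|
      <= C * h ^+ 2.
Proof.
move=> lam0 trs tis jo K W; set sg : R := if s then 1 else -1.
have K0 : 0 < K by exact: Kf_gt0.
have sgn : `|sg| = 1 by rewrite /sg; case: (s); rewrite ?normrN normr1.
set mu := Num.sqrt (lam / p0).
(* Far out, [tr] and [ti] lie within [e <= 1] of functions bounded by [K], so [B] bounds both. *)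
pose B := K + 1.
(* This is the Taylor constant [P * L * Z], with far-out bounds for [1 / p], for [|q - lam|], and
   for [tr x * ti t - ti x * tr t]. *)
exists (2 / p0 * (lam + 1) * (2 * B ^+ 2)) => h h0 h1.
set C := 2 / p0 * (lam + 1) * (2 * B ^+ 2).
(* An extra error linear in the arbitrary [e] is harmless. Its coefficient collects [|W|] from
   averaging [1 / p], [4 B] from replacing theta by its asymptotic form, and [K ^+ 2] from the phase
   increment. *)
suff approx e : 0 < e -> e <= 1 ->
    `|sg * K ^+ 2 * sin (mu * h) - W * h / p0|
      <= C * h ^+ 2 + (`|W| + 4 * B + K ^+ 2) * e.
  apply/ler_addgt0Pr => d d0.
  pose k := `|W| + 4 * B + K ^+ 2 + 1.
  have k0 : 0 < k.
    by have := normr_ge0 W; have := sqr_ge0 K; rewrite /k /B; lra.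
  pose e := Num.min 1 (d / k).
  have e0 : 0 < e by rewrite lt_min ltr01/= divr_gt0.
  have e1 : e <= 1 by rewrite ge_min lexx.
  apply: le_trans (approx e e0 e1) _; rewrite lerD2l.
  have : e <= d / k by rewrite ge_min lexx orbT.
  by rewrite ler_pdivlMr// /k; nra.
move=> e0 e1.
have [X1 H1] := pV_cvg e e0.
have [X2 H2] := pV_le.
have [X3 H3] := q_cvg hA _ (@ltr01 R).
have [X4 H4] := jost_close _ _ _ _ _ lam0 jo e0.
have [X5 H5] := sqrt_quot_cvg hA lam _ e0.
pose x := Num.max 0 (Num.max X1 (Num.max X2 (Num.max X3 (Num.max X4 X5)))).
have : x <= x by []; rewrite {1}/x !ge_max => /and5P[xge x1 x2 x3 /andP[x4 x5]].
(* This combination is the solution that vanishes at [x]; its quasi-derivative there is the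
   Wronskian [W]. *)
pose z t := tr x * ti t - ti x * tr t.
have zs : sol_qd p q lam (fun t => tr x * ti t + (- ti x) * tr t)
    (fun t => tr x * ti1 t + (- ti x) * tr1 t) by exact: sol_qd_comb.
have bd t : x <= t -> `|tr t| <= B /\ `|ti t| <= B.
  move=> xt; have [c1 c2] := H4 t ltac:(lra).
  have Kc (r : R) : `|r| <= 1 -> `|K * r| <= K.
    by move=> r1; rewrite normrM gtr0_norm// ler_piMr// ltW.
  have cb : `|K * cos (Phi p q lam t)| <= K.
    by apply: Kc; rewrite ler_norml cos_geN1 cos_le1.
  have sb : `|sg * K * sin (Phi p q lam t)| <= K.
    rewrite -mulrA normrM sgn mul1r.
    by apply: Kc; rewrite ler_norml sin_geN1 sin_le1.
  split; rewrite /B.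
  - rewrite -[tr t](subrK (K * cos (Phi p q lam t))).
    by apply: le_trans (ler_normD _ _) _; lra.
  - rewrite -[ti t](subrK (sg * K * sin (Phi p q lam t))).
    by apply: le_trans (ler_normD _ _) _; lra.
have [Tx Sx] := bd x (lexx x).
have B0 : 0 <= B by rewrite /B; lra.
have T1 : `|z (x + h) - W * Rint `[x, x + h] (fun t => (p t)^-1)| <= C * h ^+ 2.
  have WE : W = tr x * ti1 x + - ti x * tr1 x.
    by rewrite /W -(wronskian_cst _ _ _ _ _ x xge trs tis); ring.
  have zE : z (x + h) = tr x * ti (x + h) + - ti x * tr (x + h).
    by rewrite /z; ring.
  rewrite WE zE; apply: (solution_taylor _ _ _ _ _ _ _ _ xge (ltW h0) zs);
    first by ring.
  move=> t xt th; split.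
  - by have /andP[/ltW -> ->] := H2 t ltac:(lra).
  - apply: le_trans (ler_normB _ _) _; rewrite (gtr0_norm lam0).
    by have := H3 t ltac:(lra); lra.
  - apply: le_trans (ler_normD _ _) _; rewrite !normrM normrN.
    have [tb ib] := bd t xt.
    have := ler_pM (normr_ge0 _) (normr_ge0 _) Tx ib.
    have := ler_pM (normr_ge0 _) (normr_ge0 _) Sx tb.
    rewrite expr2; lra.
have T2 : `|Rint `[x, x + h] (fun t => (p t)^-1) - p0^-1 * h| <= e * h.
  apply: Rint_near_cst; first exact: ltW.
  - by apply: integrable_on_itv_sub (integrable_pV hA (x + h)).
  - by move=> t xt th; apply: H1; lra.
have T3 : `|Phi p q lam (x + h) - Phi p q lam x - mu * h| <= e * h.
  have [fi ->] := Phi_increment hA lam x h xge (ltW h0).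
  apply: Rint_near_cst => //; first exact: ltW.
  by move=> t xt th; apply: H5; lra.
have eh : e * h <= e by rewrite ler_piMr// ltW.
have T4 : `|sin (Phi p q lam (x + h) - Phi p q lam x) - sin (mu * h)| <= e.
  by apply: le_trans (sin_lipschitz _ _) _; lra.
have [c1 c2] := H4 x x4; have [c3 c4] := H4 (x + h) ltac:(lra).
have T5 : `|z (x + h) - sg * K ^+ 2 * sin (Phi p q lam (x + h) - Phi p q lam x)|
    <= 4 * B * e.
  have [tb ib] := bd (x + h) ltac:(lra).
  move: c1 c2 c3 c4; rewrite sinB /z -/K.
  set c := cos (Phi p q lam x); set s0 := sin (Phi p q lam x).
  set c' := cos (Phi p q lam (x + h)); set s' := sin (Phi p q lam (x + h)).
  move=> c1 c2 c3 c4.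
  have cb : `|K * c| <= B.
    rewrite normrM gtr0_norm//; have : `|c| <= 1 by rewrite ler_norml cos_geN1 cos_le1.
    by move=> /(ler_wpM2l (ltW K0)); rewrite mulr1 /B; lra.
  have sb : `|sg * K * s0| <= B.
    rewrite normrM normrM sgn mul1r gtr0_norm//.
    have : `|s0| <= 1 by rewrite ler_norml sin_geN1 sin_le1.
    by move=> /(ler_wpM2l (ltW K0)); rewrite mulr1 /B; lra.
  (* The four values of theta are replaced one at a time; each replacement costs at most [B * e]. *)
  have -> : tr x * ti (x + h) - ti x * tr (x + h)
       - sg * K ^+ 2 * (s' * c - c' * s0) =
     (tr x - K * c) * ti (x + h) + K * c * (ti (x + h) - sg * K * s')
     - (ti x - sg * K * s0) * tr (x + h) - sg * K * s0 * (tr (x + h) - K * c').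
    by ring.
  apply: le_trans (ler_normB _ _) _; rewrite [X in _ + X]normrM.
  have N1 := ler_normB
    ((tr x - K * c) * ti (x + h) + K * c * (ti (x + h) - sg * K * s'))
    ((ti x - sg * K * s0) * tr (x + h)).
  have N2 := ler_normD ((tr x - K * c) * ti (x + h))
    (K * c * (ti (x + h) - sg * K * s')).
  move: N1 N2; rewrite (normrM (ti x - _)) (normrM (tr x - _)) (normrM (K * c)).
  have := ler_pM (normr_ge0 _) (normr_ge0 _) c1 ib.
  have := ler_pM (normr_ge0 _) (normr_ge0 _) cb c4.
  have := ler_pM (normr_ge0 _) (normr_ge0 _) c2 tb.
  have := ler_pM (normr_ge0 _) (normr_ge0 _) sb c3.
  lra.
(* The difference telescopes through the sine of the true phase increment, [z (x + h)], and [W]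
   times the integral of [1 / p]; the pieces are controlled by [T4], [T5], [T1] and [T2]. *)
have E : sg * K ^+ 2 * sin (mu * h) - W * h / p0 =
  - (sg * K ^+ 2 * (sin (Phi p q lam (x + h) - Phi p q lam x) - sin (mu * h)))
  - (z (x + h) - sg * K ^+ 2 * sin (Phi p q lam (x + h) - Phi p q lam x))
  + (z (x + h) - W * Rint `[x, x + h] (fun t => (p t)^-1))
  + W * (Rint `[x, x + h] (fun t => (p t)^-1) - p0^-1 * h) by ring.
rewrite E.
set A1 := sg * K ^+ 2 * _; set A2 := z (x + h) - sg * _ * _.
set A3 := z (x + h) - W * _; set A4 := W * (_ - _).
have a1 : `|A1| <= K ^+ 2 * e.
  rewrite /A1 normrM normrM sgn mul1r (ger0_norm (sqr_ge0 K)).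
  by rewrite ler_wpM2l// sqr_ge0.
have a4 : `|A4| <= `|W| * e.
  by rewrite /A4 normrM ler_wpM2l//; apply: le_trans T2 eh.
apply: le_trans (ler_normD _ _) _.
have n1 := ler_normD (- A1 - A2) A3.
have n2 := ler_normB (- A1) A2; rewrite normrN in n2.
lra.
Qed.

(** Second limit: after division by [h] the quadratic error is linear in [h], so the slopes at
    [h = 0] agree, [W / p0 = +- K^2 sqrt (lam / p0)]. *)
Lemma jost_wronskian lam s tr tr1 ti ti1 :
  0 < lam -> sol_qd p q lam tr tr1 -> sol_qd p q lam ti ti1 ->
  is_jost p dp q dq lam s tr ti ->
  tr 0 * ti1 0 - tr1 0 * ti 0
    = (if s then 1 else -1) * (Num.sqrt (p0 * lam) * Kf p q lam ^+ 2).
Proof.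
move=> lam0 trs tis jo.
have [C HC] := jost_wronskian_small_step _ _ _ _ _ _ lam0 trs tis jo.
move: HC; set W := _ - _; set K := Kf p q lam; set sg : R := if s then 1 else -1.
set mu := Num.sqrt (lam / p0) => HC.
have p0p := p0_gt0 hA.
have sgn : `|sg| = 1 by rewrite /sg; case: (s); rewrite ?normrN normr1.
have mu0 : 0 <= mu by exact: sqrtr_ge0.
pose D := C + K ^+ 2 * mu ^+ 2.
have lin h : 0 < h -> h <= 1 -> `|sg * K ^+ 2 * mu - W / p0| <= D * h.
  move=> h0 h1; have := HC h h0 h1 => hh.
  have s1 := sin_near0 (mu * h) (mulr_ge0 mu0 (ltW h0)).
  rewrite -(ler_pM2r h0).
  have -> : `|sg * K ^+ 2 * mu - W / p0| * h = `|(sg * K ^+ 2 * mu - W / p0) * h|.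
    by rewrite normrM (gtr0_norm h0).
  have -> : (sg * K ^+ 2 * mu - W / p0) * h =
    (sg * K ^+ 2 * sin (mu * h) - W * h / p0)
     - sg * K ^+ 2 * (sin (mu * h) - mu * h) by ring.
  apply: le_trans (ler_normB _ _) _.
  have : `|sg * K ^+ 2 * (sin (mu * h) - mu * h)| <= K ^+ 2 * (mu * h) ^+ 2.
    rewrite normrM normrM sgn mul1r (ger0_norm (sqr_ge0 K)).
    by rewrite ler_wpM2l// sqr_ge0.
  by rewrite /D exprMn; lra.
have z : `|sg * K ^+ 2 * mu - W / p0| <= 0.
  (* The limit is taken along [h = 2^-n]. *)
  apply: (@le0_geometric _ _ D) => n.
  rewrite -ler_pdivlMr ?exprn_gt0//; apply: lin.
    by rewrite invr_gt0 exprn_gt0.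
  by rewrite invf_le1 ?exprn_gt0// exprn_ege1// ler1n.
move: z; rewrite normr_le0 subr_eq0 => /eqP z.
have pm : p0 * mu = Num.sqrt (p0 * lam).
  rewrite -[X in X * mu](ger0_norm (ltW p0p)) -sqrtr_sqr -sqrtrM ?sqr_ge0//.
  by congr Num.sqrt; field; rewrite gt_eqF.
have -> : W = p0 * (W / p0) by field; rewrite gt_eqF.
by rewrite -z -pm; ring.
Qed.

(** If both parts of theta vanished at [0], so would their Wronskian, whose value is nonzero. *)
Lemma jost_ne0 lam s tr ti : 0 < lam -> is_jost p dp q dq lam s tr ti ->
  (p 0 * tr 0, p 0 * ti 0) <> (0, 0).
Proof.
move=> lam0 jo; have [[tr1 trs] [ti1 tis] _] := jo => -[] /eqP + /eqP.
have pn : p 0 != 0 by rewrite gt_eqF// (p_gt0 hA).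
rewrite !mulf_eq0 !(negbTE pn)/= => /eqP t0 /eqP i0.
have := jost_wronskian _ _ _ _ _ _ lam0 trs tis jo.
rewrite t0 i0 mul0r mulr0 subr0 => /esym/eqP.
have : 0 < Num.sqrt (p0 * lam) * Kf p q lam ^+ 2.
  by rewrite mulr_gt0// ?exprn_gt0 ?Kf_gt0// sqrtr_gt0 mulr_gt0// (p0_gt0 hA).
move=> /lt0r_neq0/negbTE Kn; rewrite mulf_eq0 Kn orbF.
by case: (s); rewrite ?oppr_eq0 oner_eq0.
Qed.

(** The regular solution is [kappa / W] times the imaginary part of [theta e^{-i eta}]. Inserting
    [theta = K e^{i Phi} (1 + O(eps))] and [W = sqrt (p0 lam) K^2] gives the amplitude and the
    phase. *)
Lemma regular_asymptotics lam phi tr ti eta : 0 < lam ->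
  is_regular p q lam phi -> is_jost p dp q dq lam true tr ti ->
  let kappa := Num.sqrt ((p 0 * tr 0) ^+ 2 + (p 0 * ti 0) ^+ 2) in
  p 0 * tr 0 = kappa * cos eta -> p 0 * ti 0 = kappa * sin eta ->
  exists C X : R, forall x, X <= x ->
    `| phi x - kappa / (Num.sqrt (p0 * lam) * Kf p q lam)
                 * sin (Phi p q lam x - eta) | <= C * eps dp dq x.
Proof.
move=> lam0 [phi1 [phis ph0 ph1]] jo kappa kc ks.
have [[tr1 trs] [ti1 tis] [C [X HX]]] := jo.
have [Y [Y0 HY]] := amod_eventually hA _ lam0.
have := jost_wronskian _ _ _ _ _ _ lam0 trs tis jo.
set W := _ - _; set K := Kf p q lam; set r := Num.sqrt (p0 * lam).
rewrite mul1r => WE.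
have K0 : 0 < K by exact: Kf_gt0.
have r0 : 0 < r by rewrite sqrtr_gt0 mulr_gt0// (p0_gt0 hA).
have W0 : 0 < W by rewrite WE mulr_gt0// exprn_gt0.
have kap0 : 0 <= kappa by exact: sqrtr_ge0.
exists (kappa / W * (2 * C * K)), (Num.max X Y) => x; rewrite ge_max => /andP[Xx Yx].
have xge : 0 <= x by lra.
have w1 := wronskian_cst _ _ _ _ _ _ xge phis tis.
have w2 := wronskian_cst _ _ _ _ _ _ xge phis trs.
have w3 := wronskian_cst _ _ _ _ _ _ xge trs tis.
(* Cramer's rule: the Wronskians of [phi] with [tr] and [ti], read off at [0], are [- p 0 * tr 0]
   and [- p 0 * ti 0]. *)
have phW : phi x = kappa / W * (ti x * cos eta - tr x * sin eta).
  have : phi x * W = ti x * (p 0 * tr 0) - tr x * (p 0 * ti 0).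
    move: w1 w2; rewrite ph0 ph1 !mul0r !sub0r /W -w3 => w1 w2.
    have -> : phi x * (tr x * ti1 x - tr1 x * ti x) =
      tr x * (phi x * ti1 x - phi1 x * ti x) - ti x * (phi x * tr1 x - phi1 x * tr x).
      by ring.
    by rewrite w1 w2; ring.
  rewrite kc ks => h; rewrite -[LHS](mulfK (lt0r_neq0 W0)) h; ring.
have := HX x Xx; rewrite /a_re /a_im HY// mul1r -/K.
set u := tr x - _; set v := ti x - _ => hs.
have [h1 h2] := le_sqrt_sumsq u v.
have -> : phi x - kappa / (r * K) * sin (Phi p q lam x - eta) =
    kappa / W * (v * cos eta - u * sin eta).
  have -> : kappa / (r * K) = kappa / W * K.
    by rewrite WE; field; rewrite !gt_eqF.
  by rewrite phW /u /v sinB; ring.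
rewrite normrM (ger0_norm (divr_ge0 kap0 (ltW W0))) -[X in _ <= X]mulrA.
apply: ler_wpM2l; first exact: divr_ge0 kap0 (ltW W0).
apply: le_trans (ler_normB _ _) _; rewrite !normrM.
have cb : `|cos eta| <= 1 by rewrite ler_norml cos_geN1 cos_le1.
have sb : `|sin eta| <= 1 by rewrite ler_norml sin_geN1 sin_le1.
have := ler_piMr (normr_ge0 v) cb; have := ler_piMr (normr_ge0 u) sb.
lra.
Qed.

End Solutions.

(** * Absence of positive eigenvalues *)

Section Energy.
Context {R : realType} {p dp q dq : R -> R} {x0 p0 : R}.
Context (hA : assumptionA p dp q dq x0 p0).
Implicit Types (lam x b e h : R) (y z u du : R -> R).

(** Let [E z] be the maximum. No value of [E] differs from [E a] by more than [E z / 4]; at [z] this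
    gives [E z <= 4/3 E a], and then at [b] it gives [E b >= 2/3 E a]. *)
Lemma integral_growth_lower (E dE k : R -> R) a b : a <= b ->
  ac_on a b E dE -> (forall t, a <= t -> t <= b -> 0 <= E t) ->
  integrable_on `[a, b] k -> (forall t, a <= t -> t <= b -> 0 <= k t) ->
  (forall t, a <= t -> t <= b -> `|dE t| <= k t * E t) ->
  Rint `[a, b] k <= 1 / 4 -> E a / 2 <= E b.
Proof.
move=> ab Eac E0 ki k0 dEk kint.
have [z] := EVT_max ab (ac_on_continuous _ _ _ _ Eac).
rewrite in_itv/= => /andP[az zb] zmax.
have Ez t : a <= t -> t <= b -> E t <= E z.
  by move=> ta tb; apply: zmax; rewrite in_itv/= ta.
have inc t : a <= t -> t <= b -> `|E t - E a| <= E z / 4.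
  move=> ta tb; rewrite (Eac.2 a t)// addrAC subrr add0r.
  have ki' : integrable_on `[a, t] k by exact: integrable_on_itv_sub ki.
  apply: (@le_trans _ _ (Rint `[a, t] (fun s => E z * k s))).
    apply: le_norm_Rint => //.
    - exact: ac_on_integrable Eac _ _ _ _.
    - exact: integrable_onZ.
    - move=> s /=; rewrite in_itv/= => /andP[sa st].
      apply: le_trans (dEk s _ _) _; [lra..|].
      by rewrite mulrC ler_wpM2r ?k0// ?Ez//; lra.
  rewrite RintZ// -[leRHS]/(E z * 4^-1) ler_wpM2l ?E0//.
  rewrite -[leRHS]mul1r; apply: le_trans kint.
  rewrite (Rint_cat a t b)// lerDl; apply: Rint_ge0 => s /=.
  by rewrite in_itv/= => /andP[ts sb]; apply: k0; lra.
have := inc z az zb; have := inc b ab (lexx b).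
have := E0 z az zb; have := E0 a (lexx a) ab.
by rewrite !ler_norml => ? ? /andP[? ?] /andP[? ?]; lra.
Qed.

(** The weight [p (lam - q)] is chosen so that the terms in [y y1] cancel in the derivative, leaving
    [(p (lam - q))' y^2]. *)
Definition energy lam y (y1 : R -> R) x : R :=
  y1 x ^+ 2 + p x * (lam - q x) * y x ^+ 2.

Lemma coefficients_eventually lam : 0 < lam -> exists X : R,
  [/\ 0 <= X, x0 <= X & forall x, X <= x ->
    [/\ 0 < p x <= 2 * p0, `|q x| <= lam / 2 &
        p0 * lam / 4 <= p x * (lam - q x) <= 3 * p0 * lam]].
Proof.
move=> lam0; have p0p := p0_gt0 hA.
have [X1 H1] := p_cvg hA (p0 / 2) ltac:(lra).
have [X2 H2] := q_cvg hA (lam / 2) ltac:(lra).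
exists (Num.max 0 (Num.max x0 (Num.max X1 X2))); split.
- by rewrite le_max lexx.
- by rewrite !le_max lexx orbT.
move=> x; rewrite !ge_max => /and4P[xge _ Xx1 Xx2].
have := H1 x Xx1; rewrite ler_norml => /andP[p1 p2].
have qx := H2 x Xx2; have /andP[q1 q2] : - (lam / 2) <= q x <= lam / 2.
  by rewrite -ler_norml.
have l1 : p0 / 2 <= p x by lra.
have l2 : p x <= 2 * p0 by lra.
have l3 : lam / 2 <= lam - q x by lra.
have l4 : lam - q x <= 3 / 2 * lam by lra.
split=> //; first by apply/andP; split; lra.
apply/andP; split.
 - have -> : p0 * lam / 4 = (p0 / 2) * (lam / 2) by field.
  by apply: ler_pM => //; lra.
- have -> : 3 * p0 * lam = (2 * p0) * (3 / 2 * lam) by field.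
  by apply: ler_pM => //; lra.
Qed.

(** The logarithmic derivative of the energy is at most a multiple of [|p'| + |q'|], whose tail
    integral is small. The threshold is chosen before the solution. *)
Lemma energy_lower lam : 0 < lam -> exists X : R, 0 <= X /\
  forall y y1, sol_qd p q lam y y1 -> forall x b, X <= x -> x <= b ->
    energy lam y y1 x / 2 <= energy lam y y1 b.
Proof.
move=> lam0; have p0p := p0_gt0 hA.
have [X1 [X10 X1x0 H1]] := coefficients_eventually _ lam0.
(* [m] bounds [p (lam - q)] from below, so [y^2] is at most the energy over [m]; [k (|dp| + |dq|)]
   bounds the derivative of [p (lam - q)]. A tail below [m / (4 k)] then makes the integrated rate
   at most [1 / 4]. *)
pose m := p0 * lam / 4; pose k := 2 * p0 + 3 / 2 * lam.
have m0 : 0 < m by rewrite /m divr_gt0// mulr_gt0.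
have k0 : 0 < k by rewrite /k; lra.
have [X2 H2] := eps_cvg hA (m / (4 * k)) ltac:(by rewrite divr_gt0// mulr_gt0).
exists (Num.max X1 X2); split; first by rewrite le_max X10.
move=> y y1 ys x b; rewrite ge_max => /andP[X1x X2x] xb.
have b0 : 0 <= b by lra.
have [yac0 y1ac0] := sol_qd_ac _ _ _ _ b0 ys.
have xge : 0 <= x by lra.
have yac := ac_on_sub _ _ _ _ _ _ xge (lexx b) yac0.
have y1ac := ac_on_sub _ _ _ _ _ _ xge (lexx b) y1ac0.
have pac := ac_on_sub _ _ _ _ _ _ xge (lexx b) (p_ac hA b).
have qac := ac_on_sub _ _ _ _ _ _ (le_trans X1x0 X1x) (lexx b) (q_ac hA b).
have lqac := ac_onB _ _ _ _ _ _ (ac_on_cst x b lam) qac.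
have rac := ac_onM _ _ _ _ _ _ pac lqac.
pose dr t := dp t * (lam - q t) + (0 - dq t) * p t.
have Eac : ac_on x b (energy lam y y1) (fun t => dr t * y t ^+ 2).
  have := ac_onD _ _ _ _ _ _ (ac_onM _ _ _ _ _ _ y1ac y1ac)
    (ac_onM _ _ _ _ _ _ rac (ac_onM _ _ _ _ _ _ yac yac)).
  apply: ac_on_eq => t xt tb; first by rewrite /energy; ring.
  have [/andP[pt _] _ _] := H1 t ltac:(lra).
  by rewrite /dr; field; rewrite gt_eqF.
have ei := integrable_variation hA _ (le_trans X1x0 X1x).
have eib : integrable_on `[x, b] (fun t => `|dp t| + `|dq t|).
  by apply: integrable_on_sub ei => //; apply: subset_itvl; rewrite bnd_simp.
apply: (@integral_growth_lower _ _ (fun t => k / m * (`|dp t| + `|dq t|)) _ _ xb Eac).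
- move=> t xt tb; have [_ _ /andP[rt _]] := H1 t ltac:(lra).
  rewrite /energy addr_ge0 ?sqr_ge0// mulr_ge0 ?sqr_ge0//.
  by apply: le_trans rt; exact: ltW.
- exact: integrable_onZ.
- by move=> t _ _; rewrite mulr_ge0 ?addr_ge0// divr_ge0// ltW.
- move=> t xt tb; have [/andP[p1 p2] q1 /andP[r1 r2]] := H1 t ltac:(lra).
  rewrite normrM (ger0_norm (sqr_ge0 _)).
  have d1 : `|dr t| <= k * (`|dp t| + `|dq t|).
    apply: le_trans (ler_normD _ _) _; rewrite !normrM sub0r normrN (gtr0_norm p1).
    have lq : `|lam - q t| <= 3 / 2 * lam.
      by apply: le_trans (ler_normB _ _) _; rewrite (gtr0_norm lam0); lra.
    have := ler_wpM2l (normr_ge0 (dp t)) lq.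
    have := ler_wpM2l (normr_ge0 (dq t)) p2.
    have := mulr_ge0 (normr_ge0 (dp t)) (ltW p0p).
    have := mulr_ge0 (normr_ge0 (dq t)) (ltW lam0).
    rewrite /k; lra.
  have yE : y t ^+ 2 <= energy lam y y1 t / m.
    rewrite ler_pdivlMr// /energy mulrC.
    have := ler_wpM2r (sqr_ge0 (y t)) r1; have := sqr_ge0 (y1 t).
    rewrite /m; lra.
  apply: le_trans (ler_pM (normr_ge0 _) (sqr_ge0 _) d1 yE) _.
  by rewrite le_eqVlt; apply/orP; left; apply/eqP; ring.
- rewrite RintZ//.
  have : Rint `[x, b] (fun t => `|dp t| + `|dq t|) <= m / (4 * k).
    apply: le_trans (H2 x X2x); rewrite /eps (Rint_cat_infty x b)// lerDl.
    by apply: Rint_ge0 => t _; rewrite addr_ge0.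
  move=> /(ler_wpM2l (divr_ge0 (ltW k0) (ltW m0))) /le_trans; apply.
  by rewrite le_eqVlt; apply/orP; left; apply/eqP; field; rewrite !gt_eqF.
Qed.

(** The size [|y| + |y1|] satisfies the backward Gronwall hypothesis, with length measured by the
    integral of [1 / p + |q - lam|]; this suits a [q] that is merely integrable near [0]. *)
Lemma solution_backward_unique lam y y1 b : 0 <= b -> sol_qd p q lam y y1 ->
  y b = 0 -> y1 b = 0 -> forall x, 0 <= x -> x <= b -> y x = 0.
Proof.
move=> b0 ys yb y1b x xge xb.
have [yac y1ac] := sol_qd_ac _ _ _ _ b0 ys.
pose k t := (p t)^-1 + `|q t - lam|.
have ki : integrable_on `[0, b] k.
  apply: integrable_onD => //; first exact: (integrable_pV hA).
  apply: integrable_on_norm => //; apply: integrable_onB => //.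
    exact: (integrable_q hA).
  exact: integrable_on_cst.
have Mac := ac_on_Rint _ _ _ ki.
have [B1 [_ HB1]] := ac_on_bounded _ _ _ _ yac.
have [B2 [_ HB2]] := ac_on_bounded _ _ _ _ y1ac.
have k0 t : 0 <= t -> 0 <= k t.
  by move=> t0; rewrite addr_ge0// invr_ge0 ltW// (p_gt0 hA).
have N0 : `|y x| + `|y1 x| = 0.
  apply: (@backward_vanishing _ (fun t => `|y t| + `|y1 t|)
    (fun t => Rint `[0, t] k) 0 b (B1 + B2)) => //.
  - exact: ac_on_continuous Mac.
  - move=> s t s0 st tb; rewrite (Mac.2 s t)// lerDl.
    by apply: Rint_ge0 => r /=; rewrite in_itv/= => /andP[sr _]; apply: k0; lra.
  - by move=> t t0 tb; rewrite addr_ge0//= lerD// ?HB1 ?HB2.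
  - move=> s t L s0 st tb Nt HL.
    have [yt y1t] : y t = 0 /\ y1 t = 0.
      have := normr_ge0 (y t); have := normr_ge0 (y1 t) => h1 h2.
      by split; apply: normr0_eq0; lra.
    rewrite (Mac.2 s t)// addrAC subrr add0r.
    have kst : integrable_on `[s, t] k by exact: integrable_on_itv_sub ki.
    have e1 : `|y s| = `|Rint `[s, t] (fun r => y1 r / p r)|.
      by rewrite -normrN; congr (`|_|); have := yac.2 s t s0 st tb; rewrite yt; lra.
    have e2 : `|y1 s| = `|Rint `[s, t] (fun r => (q r - lam) * y r)|.
      by rewrite -normrN; congr (`|_|); have := y1ac.2 s t s0 st tb; rewrite y1t; lra.
    have i1 := ac_on_integrable _ _ _ _ yac s t s0 tb.
    have i2 := ac_on_integrable _ _ _ _ y1ac s t s0 tb.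
    rewrite e1 e2 -RintZ//.
    apply: le_trans (lerD (le_normr_Rintegral _ i1) (le_normr_Rintegral _ i2)) _ => //.
    rewrite -RintegralD//; [|exact: integrable_on_norm..].
    apply: le_Rint => //.
    - by apply: integrable_onD => //; exact: integrable_on_norm.
    - exact: integrable_onZ.
    move=> r /=; rewrite in_itv/= => /andP[sr rt].
    have pr : 0 <= (p r)^-1 by rewrite invr_ge0 ltW// (p_gt0 hA); lra.
    rewrite !normrM (ger0_norm pr) /k mulrDr.
    have := HL r sr rt; have := normr_ge0 (y r); have := normr_ge0 (y1 r).
    move=> h1 h2 h3; apply: lerD.
      by apply: ler_wpM2r => //; lra.
    by rewrite mulrC; apply: ler_wpM2r => //; lra.
  - by rewrite yb y1b normr0 addr0.
have := normr_ge0 (y x); have := normr_ge0 (y1 x) => h1 h2.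
by apply: normr0_eq0; lra.
Qed.

End Energy.

(** Pointwise [|f| <= d + f^2 / d] for every [d > 0]; integrating leaves [d (b - a)], which is
    arbitrarily small. *)
Lemma Rint_norm_eq0 (R : realType) (f : R -> R) (a b : R) : a <= b ->
  integrable_on `[a, b] f -> integrable_on `[a, b] (fun t => f t ^+ 2) ->
  Rint `[a, b] (fun t => f t ^+ 2) = 0 -> Rint `[a, b] (fun t => `|f t|) = 0.
Proof.
move=> ab fi f2i f20; apply/eqP; rewrite eq_le; apply/andP; split; last first.
  by apply: Rint_ge0.
apply/ler_addgt0Pr => e e0; rewrite add0r.
pose d := e / (b - a + 1); have d0 : 0 < d by rewrite divr_gt0//; lra.
apply: (@le_trans _ _ (Rint `[a, b] (fun t => d + d^-1 * f t ^+ 2))).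
  apply: le_Rint => //; first exact: integrable_on_norm.
    apply: integrable_onD => //; first exact: integrable_on_cst.
    exact: integrable_onZ.
  move=> t _; have [h|h] := leP `|f t| d.
    have : 0 <= d^-1 * f t ^+ 2 by rewrite mulr_ge0 ?sqr_ge0// invr_ge0 ltW.
    lra.
  have : `|f t| <= d^-1 * f t ^+ 2.
    rewrite ler_pdivlMl// -real_normK ?num_real// expr2 ler_wpM2r//.
    exact: ltW.
  lra.
rewrite RintD//; [|exact: integrable_on_cst|exact: integrable_onZ].
rewrite (RintZ _ d^-1)// f20 mulr0 addr0 Rint_cst// /d mulrAC ler_pdivrMr; last lra.
nra.
Qed.

(** * From the form equation to genuine solutions, and their vanishing *)

Section WeakSolutions.
Context {R : realType} {p dp q dq : R -> R} {x0 p0 : R}.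
Context (hA : assumptionA p dp q dq x0 p0).
Implicit Types (lam x b e h : R) (y z u du g dg : R -> R).

Lemma in_H10_ac u du b : in_H10 u du -> ac_on 0 b u du.
Proof.
move=> [uE _ _]; have [b0|b0] := leP 0 b; last first.
  split=> [|x y ? ? ?]; last by exfalso; lra.
  by apply: integrable_on_itv_sub (uE 0 (lexx 0)).1 => //; exact: ltW.
apply: ac_on_from => [|x xge _]; first by have [] := uE b b0.
by rewrite (uE x xge).2 (uE 0 (lexx 0)).2 Rint_itv1 add0r.
Qed.

(** Zero mean makes the primitive of [k] return to [0] at [b], so its extension by zero is an
    admissible test function. *)
Lemma in_H10_supported (k : R -> R) b : 0 <= b ->
  integrable_on `[0, b] k -> integrable_on `[0, b] (fun t => k t ^+ 2) ->
  Rint `[0, b] k = 0 ->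
  let dg t := if t <= b then k t else 0 in
  let g x := Rint `[0, x] dg in
  in_H10 g dg /\ forall x, b <= x -> g x = 0.
Proof.
move=> b0 ki k2i kint dg g.
have dgk t : t <= b -> dg t = k t by rewrite /dg => ->.
have dg0 t : b < t -> dg t = 0 by rewrite /dg ltNge => /negbTE ->.
have sub : (`[0, b] : set R) `<=` `[0, +oo[.
  by apply: subset_itvl; rewrite bnd_simp.
have out t : `[0, +oo[%classic t -> ~ `[0, b]%classic t -> b < t.
  move=> /=; rewrite !in_itv/= andbT => t0 /negP; rewrite t0/= -ltNge//.
have dgi : integrable_on `[0, b] dg.
  by apply: integrable_on_eq ki => // t /=; rewrite in_itv/= => /andP[_ /dgk].
have g0 x : b <= x -> g x = 0.
  move=> bx; rewrite /g (@Rint_supp _ `[0, b]).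
  - apply: etrans _ kint; apply: eq_Rint => t /=.
    by rewrite in_itv/= => /andP[_]; exact: dgk.
  - by apply: subset_itvl; rewrite bnd_simp.
  - move=> t /=; rewrite !in_itv/= => /andP[t0 _] /negP; rewrite t0/= -ltNge.
    exact: dg0.
split=> //; split.
- move=> x xge; split=> //; apply: (@integrable_on_sub _ _ `[0, +oo[) => //.
    by apply: subset_itvl; rewrite bnd_simp.
  by apply: integrable_on_supp dgi => // t h1 h2; apply: dg0; exact: out.
- apply: (@integrable_on_supp _ `[0, b]) => //.
    by move=> t h1 h2; rewrite g0 ?expr0n// ltW//; exact: out.
  have gac := ac_on_Rint _ _ _ dgi.
  exact: integrable_on_acM (integrable_on_ac _ _ _ _ gac) gac.
- apply: (@integrable_on_supp _ `[0, b]) => //.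
    by move=> t h1 h2; rewrite dg0 ?expr0n//; exact: out.
  by apply: integrable_on_eq k2i => // t /=; rewrite in_itv/= => /andP[_ /dgk ->].
Qed.

(** The real eigenvalue equation, which the real and imaginary parts of an eigenfunction satisfy
    separately. *)
Definition weak_solution lam u du : Prop := in_H10 u du /\
  forall g dg, in_H10 g dg -> bform p q u du g dg = lam * ip u g.

(* Du Bois-Reymond: with [c] the mean over [0, b] of [p du - Q], the primitive of
   [k] is an admissible test function and the weak equation reads
   [\int_0^b k^2 = 0].  Keeping this form avoids statements almost everywhere. *)
Lemma weak_solution_mean lam u du b : 0 < b -> weak_solution lam u du ->
  let Q x := Rint `[0, x] (fun t => (q t - lam) * u t) in
  exists c, let k t := p t * du t - Q t - c in
    [/\ integrable_on `[0, b] k, integrable_on `[0, b] (fun t => k t ^+ 2) &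
        Rint `[0, b] (fun t => k t ^+ 2) = 0].
Proof.
move=> b0 [uH weak] Q; have bge := ltW b0.
have uac := in_H10_ac _ _ b uH; have pac := p_ac hA b.
have qi : integrable_on `[0, b] q by exact: (integrable_q hA).
have qui : integrable_on `[0, b] (fun t => (q t - lam) * u t).
  apply: integrable_on_acM uac; apply: integrable_onB => //.
  exact: integrable_on_cst.
have Qac : ac_on 0 b Q (fun t => (q t - lam) * u t) by exact: ac_on_Rint.
have Qi := integrable_on_ac _ _ _ _ Qac.
have dui : integrable_on `[0, b] du by exact: uac.1.
have du2i : integrable_on `[0, b] (fun t => du t ^+ 2).
  have [_ _] := uH; apply: integrable_on_sub => //.
  by apply: subset_itvl; rewrite bnd_simp.
pose h t := p t * du t - Q t.
have pdui : integrable_on `[0, b] (fun t => p t * du t).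
  apply: integrable_on_eq (integrable_on_acM _ _ _ _ _ dui pac) => // t _.
  by rewrite mulrC.
have hi : integrable_on `[0, b] h by exact: integrable_onB.
pose c := Rint `[0, b] h / b.
pose k t := h t - c.
have cac := ac_on_cst 0 b c.
have ki : integrable_on `[0, b] k.
  by apply: integrable_onB => //; exact: integrable_on_cst.
have Qcac := ac_onD _ _ _ _ _ _ Qac cac.
have k2i : integrable_on `[0, b] (fun t => k t ^+ 2).
  have i1 := integrable_on_acM _ _ _ _ _ (integrable_on_acM _ _ _ _ _ du2i pac) pac.
  have i2 := integrable_on_acM _ _ _ _ _
    (integrable_onZ _ 2 _ (measurable_itv _) pdui) Qcac.
  have i3 := integrable_on_acM _ _ _ _ _ (integrable_on_ac _ _ _ _ Qcac) Qcac.
  have := integrable_onD _ _ _ (measurable_itv _)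
    (integrable_onB _ _ _ (measurable_itv _) i1 i2) i3.
  by apply: integrable_on_eq => // t _; rewrite /k /h; ring.
have k0 : Rint `[0, b] k = 0.
  rewrite RintB//; last exact: integrable_on_cst.
  by rewrite Rint_cst// subr0 /c mulfVK ?subrr// gt_eqF.
exists c; split=> //.
have [gH g0] := in_H10_supported k b bge ki k2i k0.
move: gH g0; set dg := (fun t : R => if t <= b then k t else 0).
set g := (fun x : R => Rint `[0, x] dg) => gH g0'.
have g0 x : b <= x -> g x = 0 by exact: g0'.
have dgk t : t <= b -> dg t = k t by rewrite /dg => ->.
have dg0 t : b < t -> dg t = 0 by rewrite /dg ltNge => /negbTE ->.
have gac := in_H10_ac _ _ b gH.
have sub : (`[0, b] : set R) `<=` `[0, +oo[.
  by apply: subset_itvl; rewrite bnd_simp.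
have out t : `[0, +oo[%classic t -> ~ `[0, b]%classic t -> b < t.
  by move=> /=; rewrite !in_itv/= andbT => t0 /negP; rewrite t0/= -ltNge.
have bE : bform p q u du g dg
    = Rint `[0, b] (fun t => p t * du t * dg t + q t * u t * g t).
  apply: Rint_supp => // t h1 h2; have bt := out t h1 h2.
  by rewrite dg0// g0 ?ltW// !mulr0 addr0.
have ipE : ip u g = Rint `[0, b] (fun t => u t * g t).
  by apply: Rint_supp => // t h1 h2; rewrite g0 ?mulr0// ltW//; exact: out.
have := weak g dg gH; rewrite bE ipE.
have dgi : integrable_on `[0, b] dg by exact: gac.1.
have pdgi : integrable_on `[0, b] (fun t => p t * du t * dg t).
  have := integrable_onD _ _ _ (measurable_itv _) k2i
    (integrable_on_acM _ _ _ _ _ ki Qcac).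
  apply: integrable_on_eq => // t /=; rewrite in_itv/= => /andP[_ /dgk ->].
  by rewrite /k /h; ring.
have qugi : integrable_on `[0, b] (fun t => q t * u t * g t).
  exact: integrable_on_acM (integrable_on_acM _ _ _ _ _ qi uac) gac.
have ugi : integrable_on `[0, b] (fun t => u t * g t).
  exact: integrable_on_acM (integrable_on_ac _ _ _ _ uac) gac.
have Qgi := ac_onM _ _ _ _ _ _ Qac gac.
(* Integration by parts of [Q g]; both boundary terms vanish because [Q 0 = 0] and [g b = 0]. *)
have := Qgi.2 0 b (lexx 0) bge (lexx b).
rewrite (g0 b (lexx b)) mulr0 {1}/Q Rint_itv1 mul0r add0r.
have dgQi : integrable_on `[0, b] (fun t => dg t * Q t).
  exact: integrable_on_acM dgi Qac.
have kQi := integrable_on_acM _ _ _ _ _ ki Qac.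
rewrite RintD//; last exact: integrable_on_acM qui gac.
rewrite RintD//.
have -> : Rint `[0, b] (fun t => (q t - lam) * u t * g t)
    = Rint `[0, b] (fun t => q t * u t * g t) - lam * Rint `[0, b] (fun t => u t * g t).
  rewrite -RintZ// -RintB//; last exact: integrable_onZ.
  by apply: eq_Rint => t _; ring.
have -> : Rint `[0, b] (fun t => p t * du t * dg t) =
   Rint `[0, b] (fun t => k t ^+ 2) + Rint `[0, b] (fun t => dg t * Q t).
  (* Adding [c k] costs nothing since [k] has zero integral, and [k^2 + c k + k Q = p du k]. *)
  have -> : Rint `[0, b] (fun t => k t ^+ 2) =
      Rint `[0, b] (fun t => k t ^+ 2 + c * k t).
    by rewrite RintD// ?RintZ// ?k0 ?mulr0 ?addr0//; exact: integrable_onZ.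
  rewrite -RintD//; last first.
    by apply: integrable_onD => //; exact: integrable_onZ.
  apply: eq_Rint => t /=; rewrite in_itv/= => /andP[_ /dgk ->].
  by rewrite /k /h; ring.
move=> e1 e2; rewrite -/k; lra.
Qed.

(** The quasi-derivative is [Q + c], once the constant [c] is known to be the same on every
    [[0, b]]. It agrees with [p du] in mean square only, and this is recorded for the energy
    bound. *)
Lemma weak_solution_sol lam u du : weak_solution lam u du ->
  exists y1, sol_qd p q lam u y1 /\ forall b, 0 <= b ->
    integrable_on `[0, b] (fun t => (p t * du t - y1 t) ^+ 2) /\
    Rint `[0, b] (fun t => (p t * du t - y1 t) ^+ 2) = 0.
Proof.
move=> us; have uH := us.1.
set Q := fun x => Rint `[0, x] (fun t => (q t - lam) * u t).
have sq0 (f : R -> R) a b : 0 <= a -> a <= b ->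
    integrable_on `[0, b] f -> integrable_on `[0, b] (fun t => f t ^+ 2) ->
    Rint `[0, b] (fun t => f t ^+ 2) = 0 ->
    Rint `[0, a] (fun t => f t ^+ 2) = 0.
  move=> a0 ab fi f2i f20; apply/eqP; rewrite eq_le; apply/andP; split.
    rewrite -[leRHS]f20 (Rint_cat 0 a b)// lerDl.
    by apply: Rint_ge0 => t _; exact: sqr_ge0.
  by apply: Rint_ge0 => t _; exact: sqr_ge0.
have [c [c1 c2 c3]] := weak_solution_mean _ _ _ 1 ltr01 us; rewrite -/Q in c1 c2 c3.
have key b : 0 <= b ->
    [/\ integrable_on `[0, b] (fun t => p t * du t - Q t - c),
     integrable_on `[0, b] (fun t => (p t * du t - Q t - c) ^+ 2) &
     Rint `[0, b] (fun t => (p t * du t - Q t - c) ^+ 2) = 0].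
  move=> b0; pose B := b + 1.
  have [d [d1 d2 d3]] := weak_solution_mean _ _ _ B ltac:(rewrite /B; lra) us.
  rewrite -/Q in d1 d2 d3.
  have B1 : 1 <= B by rewrite /B; lra.
  have i1 := integrable_on_itv_sub _ _ _ _ _ (lexx 0) B1 d1.
  have i2 := integrable_on_itv_sub _ _ _ _ _ (lexx 0) B1 d2.
  have n1 := Rint_norm_eq0 _ _ _ _ ler01 c1 c2 c3.
  have n2 := Rint_norm_eq0 _ _ _ _ ler01 i1 i2 (sq0 _ _ _ ler01 B1 d1 d2 d3).
  (* On [[0, 1]] both [p du - Q - c] and [p du - Q - d] have zero [L^1] norm, so the two constants
     coincide. Taking [B = b + 1] above ensures that both intervals contain [[0, 1]]. *)
  have cd : `|c - d| <= 0.
    have -> : `|c - d| = Rint `[0, 1] (fun=> `|c - d|).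
      by rewrite Rint_cst// subr0 mulr1.
    apply: le_trans _ (_ : Rint `[0, 1] (fun t => `|p t * du t - Q t - c|)
      + Rint `[0, 1] (fun t => `|p t * du t - Q t - d|) <= 0); last first.
      by rewrite n1 n2 addr0.
    rewrite -RintD//; [|exact: integrable_on_norm..].
    apply: le_Rint => //; first exact: integrable_on_cst.
      by apply: integrable_onD => //; exact: integrable_on_norm.
    move=> t _; rewrite [leRHS]addrC.
    have -> : c - d = (p t * du t - Q t - d) - (p t * du t - Q t - c) by ring.
    exact: ler_normB.
  have dc : d = c by move: cd; rewrite normr_le0 subr_eq0 => /eqP.
  rewrite {}dc in d1 d2 d3.
  have bB : b <= B by rewrite /B; lra.
  split; [exact: integrable_on_itv_sub d1|exact: integrable_on_itv_sub d2|].
  exact: sq0 b0 bB d1 d2 d3.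
exists (fun x => Q x + c); split; last first.
  move=> b b0; have [_ k2 k20] := key b b0; split.
    by apply: integrable_on_eq k2 => // t _; ring.
  by apply: etrans _ k20; apply: eq_Rint => t _; ring.
move=> x xge; have [k1 k2 k20] := key x xge.
have uac := in_H10_ac _ _ x uH.
have qui : integrable_on `[0, x] (fun t => (q t - lam) * u t).
  apply: integrable_on_acM uac; apply: integrable_onB => //.
    exact: (integrable_q hA).
  exact: integrable_on_cst.
have Qac : ac_on 0 x Q (fun t => (q t - lam) * u t) by exact: ac_on_Rint.
have Qci : integrable_on `[0, x] (fun t => (Q t + c) / p t).
  apply: (integrable_divp hA); apply: integrable_onD => //.
    exact: integrable_on_ac Qac.
  exact: integrable_on_cst.
have kpi := integrable_divp hA _ _ k1.
split=> //; last by rewrite {2}/Q Rint_itv1 add0r addrC.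
rewrite (uac.2 0 x)//; congr (_ + _); apply/eqP; rewrite -subr_eq0 -normr_le0.
rewrite -RintB//; last exact: uac.1.
rewrite (@eq_Rint _ _ _ (fun t => (p t * du t - Q t - c) / p t)); last first.
  move=> t /=; rewrite in_itv/= => /andP[t0 _].
  by field; rewrite gt_eqF// (p_gt0 hA).
have [C [C0 HC]] := continuous_itv_bounded _ _ _ (pV_continuous hA x).
apply: le_trans _ (_ : C * Rint `[0, x] (fun t => `|p t * du t - Q t - c|) <= 0);
  last by rewrite Rint_norm_eq0// mulr0.
rewrite -RintZ//; last exact: integrable_on_norm.
apply: le_norm_Rint => //.
  by apply: integrable_onZ => //; exact: integrable_on_norm.
move=> t /=; rewrite in_itv/= => /andP[t0 tx].
by rewrite normrM mulrC ler_wpM2r// HC.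
Qed.

(** A positive energy [e] far out would persist as [e / 2] on a half-line, while the integral of the
    energy is bounded because [u] and [du] are square integrable. Hence [u] and [y1] vanish far out,
    and backward uniqueness carries this down to [0]. *)
Lemma weak_solution_eq0 lam u du : 0 < lam -> weak_solution lam u du ->
  forall x, 0 <= x -> u x = 0.
Proof.
move=> lam0 us; have p0p := p0_gt0 hA.
have [y1 [ys y1E]] := weak_solution_sol _ _ _ us.
have [[_ u2i du2i] _] := us.
have [X1 [X10 _ H1]] := coefficients_eventually hA _ lam0.
have [X2 [X20 H2]] := energy_lower hA _ lam0.
pose X := Num.max X1 X2.
have [XX1 XX2] : X1 <= X /\ X2 <= X by rewrite !le_max !lexx orbT.
have E0 x : X <= x -> @energy _ p q lam u y1 x <= 0.
  move=> Xx; rewrite leNgt; apply/negP => Ex.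
  set e := energy lam u y1 x in Ex.
  (* A bound for the integrated energy independent of [b]: [8 p0^2] is twice the bound [(2 p0)^2]
     for [p^2], and [3 p0 lam] bounds [p (lam - q)]. *)
  pose T := 8 * p0 ^+ 2 * Rint `[0, +oo[ (fun t => du t ^+ 2)
    + 3 * p0 * lam * Rint `[0, +oo[ (fun t => u t ^+ 2).
  have bound b : x <= b -> e / 2 * (b - x) <= T.
    move=> xb; have b0 : 0 <= b by lra.
    have sub : (`[x, b] : set R) `<=` `[0, +oo[.
      by apply: subset_itv; rewrite bnd_simp; lra.
    have [k2i k20] := y1E b b0.
    have k2x : integrable_on `[x, b] (fun t => (p t * du t - y1 t) ^+ 2).
      by apply: integrable_on_itv_sub k2i; lra.
    have ux : integrable_on `[x, b] (fun t => u t ^+ 2).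
      exact: integrable_on_sub u2i.
    have dux : integrable_on `[x, b] (fun t => du t ^+ 2).
      exact: integrable_on_sub du2i.
    have mono (f : R -> R) : integrable_on `[0, +oo[ f -> (forall t, 0 <= f t) ->
        Rint `[x, b] f <= Rint `[0, +oo[ f.
      move=> fi f0; rewrite (Rint_cat_infty 0 b)//.
      rewrite (Rint_cat 0 x b)//; [|lra|]; last first.
        by apply: integrable_on_sub fi => //; apply: subset_itvl; rewrite bnd_simp.
      rewrite -addrA addrCA lerDl addr_ge0//; exact: Rint_ge0.
    have k2x0 : Rint `[x, b] (fun t => (p t * du t - y1 t) ^+ 2) <= 0.
      rewrite -[leRHS]k20 (Rint_cat 0 x b)//; last lra.
      by rewrite lerDr; apply: Rint_ge0 => t _; exact: sqr_ge0.
    rewrite -Rint_cst//.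
    pose F t := (8 * p0 ^+ 2 * du t ^+ 2 + 3 * p0 * lam * u t ^+ 2)
      + 2 * (p t * du t - y1 t) ^+ 2.
    apply: (@le_trans _ _ (Rint `[x, b] F)).
      apply: le_Rint => //; first exact: integrable_on_cst.
        apply: integrable_onD => //; last exact: integrable_onZ.
        by apply: integrable_onD => //; exact: integrable_onZ.
      move=> t /=; rewrite in_itv/= => /andP[xt tb].
      apply: le_trans (H2 _ _ ys x t _ xt) _; first lra.
      have [/andP[p1 p2] _ /andP[_ r2]] := H1 t ltac:(lra).
      rewrite /energy /F.
      have h1 := ler_wpM2r (sqr_ge0 (u t)) r2.
      have h2 : p t ^+ 2 <= 4 * p0 ^+ 2.
        by have := ler_pM (ltW p1) (ltW p1) p2 p2; rewrite !expr2; lra.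
      have h3 := ler_wpM2r (sqr_ge0 (du t)) h2.
      (* The right side minus the left side is the square of [2 p du - y1]. *)
      have h4 : y1 t ^+ 2 <= 2 * (p t ^+ 2 * du t ^+ 2) + 2 * (p t * du t - y1 t) ^+ 2.
        have := sqr_ge0 (2 * (p t * du t) - y1 t); rewrite -subr_ge0.
        by rewrite -exprMn !expr2; lra.
      lra.
    have i1 : integrable_on `[x, b] (fun t => 8 * p0 ^+ 2 * du t ^+ 2).
      exact: integrable_onZ.
    have i2 : integrable_on `[x, b] (fun t => 3 * p0 * lam * u t ^+ 2).
      exact: integrable_onZ.
    rewrite /F RintD//; last 2 first.
    - exact: integrable_onD.
    - exact: integrable_onZ.
    rewrite RintD// !RintZ//.
    have m1 := mono _ du2i (fun t => sqr_ge0 _).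
    have m2 := mono _ u2i (fun t => sqr_ge0 _).
    have c1 : 0 <= 8 * p0 ^+ 2 by rewrite mulr_ge0// sqr_ge0.
    have c2 : 0 <= 3 * p0 * lam by rewrite !mulr_ge0// ltW.
    have := ler_wpM2l c1 m1; have := ler_wpM2l c2 m2.
    rewrite /T; lra.
  have T0 : 0 <= T by have := bound x (lexx x); rewrite subrr mulr0.
  (* At this endpoint the lower bound for the integral is exactly [T + 1]. *)
  have := bound (x + 2 * ((T + 1) / e)).
  have q0 : 0 <= (T + 1) / e by rewrite divr_ge0 ?ltW//; lra.
  move=> /(_ ltac:(lra)).
  have -> : e / 2 * (x + 2 * ((T + 1) / e) - x) = T + 1.
    by field; rewrite gt_eqF.
  lra.
have zero x : X <= x -> u x = 0 /\ y1 x = 0.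
  move=> Xx; have := E0 x Xx; rewrite /energy.
  have [_ _ /andP[r1 _]] := H1 x (le_trans XX1 Xx).
  have r0 : 0 < p x * (lam - q x).
    by apply: lt_le_trans r1; rewrite divr_gt0// mulr_gt0.
  have a1 := sqr_ge0 (y1 x); have a2 := mulr_ge0 (ltW r0) (sqr_ge0 (u x)) => le0.
  have /eqP : y1 x ^+ 2 = 0 by lra.
  have /eqP : p x * (lam - q x) * u x ^+ 2 = 0 by lra.
  by rewrite mulf_eq0 gt_eqF//= !expf_eq0/= => /eqP -> /eqP ->.
move=> x xge; have [xX|/ltW xX] := leP X x; first by have [] := zero x xX.
have [uX y1X] := zero X (lexx X).
exact: (solution_backward_unique hA _ _ _ _ (le_trans xge xX) ys uX y1X).
Qed.

End WeakSolutions.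

(** Testing with functions of zero imaginary part decouples the complex identity into one weak
    equation for each of [fr] and [fi]. *)
Lemma no_positive_eigenvalue (R : realType) (p dp q dq : R -> R) (x0 p0 : R) :
  assumptionA p dp q dq x0 p0 ->
  forall lam : R, 0 < lam -> ~ is_eigenvalue p q lam.
Proof.
move=> hA lam lam0 [fr [dfr [fi [dfi [frH fiH nz eig]]]]].
have zH : in_H10 (fun=> 0 : R) (fun=> 0 : R).
  split.
  - move=> x xge; split; first exact: integrable_on_cst.
    by rewrite Rint_cst// mul0r.
  - apply: (@integrable_on_supp _ set0) => //; last exact: integrable_set0.
    by move=> x _ _; rewrite expr0n.
  - apply: (@integrable_on_supp _ set0) => //; last exact: integrable_set0.
    by move=> x _ _; rewrite expr0n.
have R0 (f : R -> R) : (forall x, 0 <= x -> f x = 0) -> Rint `[0, +oo[ f = 0.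
  move=> f0; rewrite (@Rint_supp _ set0)//; first by rewrite /Rint Rintegral_set0.
  by move=> x /=; rewrite in_itv/= andbT => /f0.
have b0 f df : bform p q f df (fun=> 0) (fun=> 0) = 0.
  by apply: R0 => x _; rewrite !mulr0 addr0.
have i0 f : @ip R f (fun=> 0) = 0 by apply: R0 => x _; rewrite mulr0.
have wr : @weak_solution _ p q lam fr dfr.
  split=> // g dg gH; have [+ _] := eig g dg _ _ gH zH.
  by rewrite b0 i0 !addr0.
have wi : @weak_solution _ p q lam fi dfi.
  split=> // g dg gH; have [_] := eig g dg _ _ gH zH.
  by rewrite b0 i0 !subr0.
have frz := weak_solution_eq0 hA _ _ _ lam0 wr.
have fiz := weak_solution_eq0 hA _ _ _ lam0 wi.
by apply: nz; rewrite /ip !R0 ?addr0// => x xge; rewrite ?frz ?fiz// mulr0.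
Qed.

(** The Jost solution enters as any pair with the prescribed asymptotics, and [eta] as any argument
    of [w(lam + i0)]; the values of a continuous branch are a special case. *)
Theorem theorem3p1 (R : realType) (p dp q dq : R -> R) (x0 p0 : R) :
  assumptionA p dp q dq x0 p0 ->
  [/\
   (* w(lam +- i0) = p(0) theta(0, lam +- i0) <> 0 *)
   (forall (lam : R) (s : bool) (tr ti : R -> R), 0 < lam ->
      is_jost p dp q dq lam s tr ti ->
      (p 0 * tr 0, p 0 * ti 0) <> (0, 0)),
   (* asymptotics of the regular solution *)
   (forall (lam : R) (phi tr ti : R -> R) (eta : R), 0 < lam ->
      is_regular p q lam phi ->
      is_jost p dp q dq lam true tr ti ->
      let kappa := Num.sqrt ((p 0 * tr 0) ^+ 2 + (p 0 * ti 0) ^+ 2) in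
      p 0 * tr 0 = kappa * cos eta ->
      p 0 * ti 0 = kappa * sin eta ->
      exists C X : R, forall x, X <= x ->
        `| phi x - kappa / (Num.sqrt (p0 * lam) * Kf p q lam)
                     * sin (Phi p q lam x - eta) | <= C * eps dp dq x) &
   (* H has no positive eigenvalues *)
   (forall lam : R, 0 < lam -> ~ is_eigenvalue p q lam)].
Proof.
move=> hA; split.
- by move=> lam s tr ti; exact: jost_ne0 hA lam s tr ti.
- by move=> lam phi tr ti eta; exact: regular_asymptotics hA lam phi tr ti eta.
- exact: no_positive_eigenvalue hA.
Qed.
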